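(* Let $X$ be a homogeneous Hilbertian operator space (with underlying Banach space $\ell_2$) such that the identity $R\to X$ has cb-norm $1$. Then $\kappa_n((X,\overline{X^*})_\theta)=n^{\theta/2}$ for all $\theta\in[0,1]$ and all $n\in\mathbb N$. In particular, $\kappa_n((R\cap C,R+C)_\theta)=n^{\theta/2}$ for all $\theta\in[0,1]$ and all $n\in\mathbb N$.
   Context: Operator spaces are complex: closed linear subspaces $X\subseteq \mathcal B(H)$ (or given by matrix norms satisfying Ruan's axioms), with $\mathrm M_n(X)$ normed through $\mathrm M_n(X)\subseteq \mathrm M_n(\mathcal B(H))\cong\mathcal B(H^{\oplus n})$. An operator space $X$ is Hilbertian if it is linearly isometric to a Hilbert space, and homogeneous if $\|u\|_{\rm cb}=\|u\|$ for every bounded linear $u\colon X\to X$, where $\|u\|_{\rm cb}=\sup_n\|u_n\|$, $u_n([x_{ij}])=[u(x_{ij})]$. For a homogeneous Hilbertian operator space $X$ with $\dim X\ge n$, $\kappa_n(X)$ is the norm in $\mathrm M_n(X)$ of the matrix whose first column is $(e_1,\dots,e_n)^T$ and whose other entries are $0$, where $\{e_1,\dots,e_n\}$ is any orthonormal set in $X$ (the value does not depend on the choice). With $e_{i,j}\in\mathcal B(\ell_2)$ the matrix units, $R=\overline{\rm span}\{e_{1,j}:j\in\mathbb N\}$, $C=\overline{\rm span}\{e_{i,1}:i\in\mathbb N\}$, both identified isometrically with $\ell_2$ through canonical isometries $r\colon\ell_2\to R$, $c\colon\ell_2\to C$; ''the identity $R\to X$'' is the identity of $\ell_2$ under this identification.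 $R\cap C$ is $\ell_2$ with the operator space structure given by $x\mapsto(r(x),c(x))\in R\oplus_\infty C$, and $R+C=(R\oplus_1C)/\Delta$, $\Delta=\{(r(x),-c(x)):x\in\ell_2\}$ (quotient structure of the operator space $\ell_1$-sum). $X^*$ is the operator space dual ($\mathrm M_n(X^* )=CB(X,\mathrm M_n(\mathbb C))$), and $\overline{E}$ is the complex conjugate operator space of $E$, with $\|[\overline{x_{ij}}]\|_{\mathrm M_n(\overline E)}=\|[x_{ij}]\|_{\mathrm M_n(E)}$. The Riesz representation gives a linear isometry $X\to\overline{X^*}$, used to interpolate. For homogeneous Hilbertian $X_0,X_1$ identified through a linear isometry (the choice is irrelevant), $(X_0,X_1)_\theta$ is the complex interpolation space with $\mathrm M_n((X_0,X_1)_\theta)=(\mathrm M_n(X_0),\mathrm M_n(X_1))_\theta$, with $(X_0,X_1)_0=X_0$, $(X_0,X_1)_1=X_1$.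
   Formalization: The ''in particular'' clause is proved for (R+C, R∩C)_θ instead of (R∩C, R+C)_θ: as printed it fails at θ=0 for n≥2, since κ_n(R∩C)=√n≠1, and it is R+C that satisfies the hypothesis on X. *)

(* Defs.v *)
From HB Require Import structures.
From mathcomp Require Import all_boot all_order all_algebra.
From mathcomp Require Import all_classical all_reals all_analysis.
From mathcomp Require Import ring.
From mathcomp.real_closed Require Export complex.

Set Implicit Arguments.
Unset Strict Implicit.
Unset Printing Implicit Defensive.

Import Order.TTheory GRing.Theory Num.Theory.
Import numFieldNormedType.Exports.

Local Open Scope classical_set_scope.
Local Open Scope ring_scope.
Local Open Scope complex_scope.

Notation normc := Normc.normc.

(** * The complex Hilbert space l2 *)

Section SquareSummable.
Variable R : realType.

Definition sqsummable : {pred (nat -> R[i])} :=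
  [pred x : nat -> R[i] | `[< cvgn (series (fun k => normc (x k) ^+ 2)) >]].

Lemma sqsummableP (x : nat -> R[i]) :
  reflect (cvgn (series (fun k => normc (x k) ^+ 2))) (x \in sqsummable).
Proof. exact: asboolP. Qed.

Lemma normc_ge0 (z : R[i]) : 0 <= normc z.
Proof. by case: z => a b; exact: Num.Theory.sqrtr_ge0. Qed.

Lemma normcD_sqr_le (a x y : R[i]) :
  normc (a * x + y) ^+ 2
    <= 2 * (normc a ^+ 2 * normc x ^+ 2) + 2 * normc y ^+ 2.
Proof.
rewrite -exprMn -Normc.normcM.
have h : normc (a * x + y) <= normc (a * x) + normc y by exact: le_normcD.
move: (normc_ge0 (a * x + y)) (normc_ge0 (a * x)) (normc_ge0 y) h.
move: (normc (a * x + y)) (normc (a * x)) (normc y) => s u v s0 u0 v0 h.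
have h2 : s ^+ 2 <= (u + v) ^+ 2 by rewrite ler_pXn2r ?nnegrE ?addr_ge0.
apply: (le_trans h2); rewrite -subr_ge0.
have -> : 2 * u ^+ 2 + 2 * v ^+ 2 - (u + v) ^+ 2 = (u - v) ^+ 2 by ring.
exact: sqr_ge0.
Qed.

Lemma sqsummable_submod_closed : submod_closed sqsummable.
Proof.
split=> [|a x y].
  apply/sqsummableP.
  have -> : (fun k => normc ((0 : nat -> R[i]) k) ^+ 2) = (fun=> 0).
    by apply/funext => k; rewrite Normc.normc0 expr0n.
  have -> : series (fun=> 0 : R) = (fun=> 0).
    by apply/funext => n; rewrite /series /= big1.
  exact: is_cvg_cst.
move=> /sqsummableP cx /sqsummableP cy; apply/sqsummableP.
pose v k := 2 * (normc a ^+ 2 * normc (x k) ^+ 2) + 2 * normc (y k) ^+ 2.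
apply: (@series_le_cvg R _ v) => [k|k|k|].
- exact: sqr_ge0.
- by rewrite addr_ge0 // mulr_ge0 ?sqr_ge0 // mulr_ge0 ?sqr_ge0.
- exact: normcD_sqr_le.
have -> : v = (2 * normc a ^+ 2) *: (fun k => normc (x k) ^+ 2)
              + 2 *: (fun k => normc (y k) ^+ 2).
  by apply/funext => k; rewrite /v mulrA.
by apply: is_cvg_seriesD; apply: is_cvg_seriesZ.
Qed.

HB.instance Definition _ :=
  GRing.isSubmodClosed.Build R[i] (nat -> R[i]) sqsummable
    sqsummable_submod_closed.

Record l2 : Type := L2 { l2val :> nat -> R[i]; l2P : l2val \in sqsummable }.

HB.instance Definition _ := [isSub for l2val].
HB.instance Definition _ := [Choice of l2 by <:].
HB.instance Definition _ := [SubChoice_isSubLmodule of l2 by <:].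

Definition l2norm (x : l2) : R :=
  Num.sqrt (limn (series (fun k => normc (x k) ^+ 2))).

Definition csum (u : nat -> R[i]) : R[i] :=
  limn (series (fun k => complex.Re (u k)))
    +i* limn (series (fun k => complex.Im (u k))).

Definition l2dot (x y : l2) : R[i] := csum (fun k => x k * (y k)^*).

Definition l2_orthonormal n (e : 'I_n -> l2) : Prop :=
  forall i j, l2dot (e i) (e j) = (i == j)%:R.

Lemma delta0_sqsummable :
  (fun k : nat => (k == 0%N)%:R : R[i]) \in sqsummable.
Proof.
apply/sqsummableP.
have -> : series (fun k => normc ((k == 0%N)%:R : R[i]) ^+ 2)
          = (fun n => (0 < n)%N%:R).
  apply/funext => -[|n]; rewrite /series /=; first by rewrite big_nil.
  rewrite big_nat_recl // (_ : normc _ = 1); last exact: Normc.normc1.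
  rewrite expr1n big1 ?addr0 // => i _.
  by rewrite (_ : normc _ = 0) ?expr0n //; exact: Normc.normc0.
apply: (cvgP (1 : R)); rewrite -cvg_shiftS /=.
exact: cvg_cst.
Qed.

Definition l2e0 : l2 := L2 delta0_sqsummable.

End SquareSummable.

(** * Matrix norms and operator spaces *)

Section OperatorSpaces.
Variable R : realType.
Local Open Scope ereal_scope.

(* A matrix norm takes values in [0, +oo]: it is +oo on the matrices that do
   not belong to the space. *)
Definition matnorm (V : Type) := forall n : nat, 'M[V]_n -> \bar R.

Definition lmulmx (V : lmodType R[i]) m n p
    (a : 'M[R[i]]_(m, n)) (x : 'M[V]_(n, p)) : 'M[V]_(m, p) :=
  \matrix_(i, j) (\sum_(k < n) a i k *: x k j)%R.

Definition rmulmx (V : lmodType R[i]) m n p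
    (x : 'M[V]_(m, n)) (b : 'M[R[i]]_(n, p)) : 'M[V]_(m, p) :=
  \matrix_(i, j) (\sum_(k < n) b k j *: x i k)%R.

Definition cvnorm n (v : 'cV[R[i]]_n) : R :=
  Num.sqrt (\sum_(i < n) normc (v i ord0) ^+ 2)%R.

Definition mxopnorm m n (a : 'M[R[i]]_(m, n)) : \bar R :=
  ereal_sup [set (cvnorm (a *m v)%R)%:E | v in [set v | (cvnorm v <= 1)%R]].

(* Ruan's axioms, together with completeness of M_1. *)
Definition operator_space (V : lmodType R[i]) (N : matnorm V) : Prop :=
  (forall n (x : 'M[V]_n), 0 <= N n x < +oo) /\
  (forall n (x : 'M[V]_n), N n x = 0 -> x = 0%R) /\
  (forall n (x y : 'M[V]_n), N n (x + y)%R <= N n x + N n y) /\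
  (forall n (c : R[i]) (x : 'M[V]_n),
     N n (map_mx ( *:%R c) x) = (normc c)%:E * N n x) /\
  (forall m n (a : 'M[R[i]]_(m, n)) (x : 'M[V]_n) (b : 'M[R[i]]_(n, m)),
     N m (rmulmx (lmulmx a x) b) <= mxopnorm a * N n x * mxopnorm b) /\
  (forall m n (x : 'M[V]_m) (y : 'M[V]_n),
     N (m + n)%N (block_mx x 0%R 0%R y) = maxe (N m x) (N n y)) /\
  (forall x : nat -> V,
     (forall e : R, (0 < e)%R -> exists K, forall j k, (K <= j)%N ->
        (K <= k)%N -> N 1%N (const_mx (x j - x k)%R) < e%:E) ->
     exists l : V, forall e : R, (0 < e)%R -> exists K, forall k,
        (K <= k)%N -> N 1%N (const_mx (x k - l)%R) < e%:E).

Definition ampnorm (V W : Type) (N : matnorm V) (N' : matnorm W)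
    (u : V -> W) (n : nat) : \bar R :=
  ereal_sup [set N' n (map_mx u x) | x in [set x | N n x <= 1]].

Definition opnorm (V W : Type) (N : matnorm V) (N' : matnorm W)
    (u : V -> W) : \bar R := ampnorm N N' u 1%N.

Definition cbnorm (V W : Type) (N : matnorm V) (N' : matnorm W)
    (u : V -> W) : \bar R := ereal_sup (range (ampnorm N N' u)).

Definition homogeneous (V : lmodType R[i]) (N : matnorm V) : Prop :=
  forall u : {linear V -> V}, opnorm N N u < +oo -> cbnorm N N u = opnorm N N u.

Definition hilbertian (N : matnorm (l2 R)) : Prop :=
  forall x : l2 R, N 1%N (const_mx x) = (l2norm x)%:E.

Definition pull (V W : Type) (f : V -> W) (N : matnorm W) : matnorm V :=
  fun n x => N n (map_mx f x).

(** ** Row and column spaces *)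

Definition l2tnorm n (xi : 'I_n -> l2 R) : R :=
  Num.sqrt (\sum_(i < n) l2norm (xi i) ^+ 2)%R.

(* M_n(B(l2)) = B(l2^n) *)
Definition Bl2 : matnorm (l2 R -> l2 R) := fun n T =>
  ereal_sup [set (l2tnorm (fun i => \sum_(j < n) T i j (xi j))%R)%:E
            | xi in [set xi | (l2tnorm xi <= 1)%R]].

(* The operator \sum_j x_j e_{1,j}. *)
Definition rop (x : l2 R) : l2 R -> l2 R :=
  fun xi => (csum (fun j => x j * xi j) *: l2e0 R)%R.

(* The operator \sum_i x_i e_{i,1}. *)
Definition cop (x : l2 R) : l2 R -> l2 R := fun xi => (xi 0%N *: x)%R.

Definition Rsp : matnorm (l2 R) := pull rop Bl2.
Definition Csp : matnorm (l2 R) := pull cop Bl2.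

(** ** Direct sums and quotients *)

Definition linf_sum (V W : Type) (E : matnorm V) (F : matnorm W) :
    matnorm (V * W)%type :=
  fun n x => maxe (E n (map_mx fst x)) (F n (map_mx snd x)).

(* The largest operator space norm for which every pair of complete
   contractions u : E -> G, v : F -> G into an operator space G induces a
   complete contraction (p, q) |-> u p + v q. *)
Definition l1_sum (V W : lmodType R[i]) (E : matnorm V) (F : matnorm W) :
    matnorm (V * W)%type :=
  fun n x => ereal_sup [set t | exists (Z : lmodType R[i]) (G : matnorm Z)
      (u : {linear V -> Z}) (v : {linear W -> Z}),
    [/\ operator_space G, cbnorm E G u <= 1, cbnorm F G v <= 1
      & t = G n (map_mx (fun p => u p.1 + v p.2)%R x)]].

(* M_n(E / D) = M_n(E) / M_n(D): the norm of the class of x. *)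
Definition quotient_sp (V : zmodType) (D : set V) (E : matnorm V) : matnorm V :=
  fun n x => ereal_inf [set E n (x + d)%R
                      | d in [set d : 'M[V]_n | forall i j, D (d i j)]].

Definition RcapC : matnorm (l2 R) := pull (fun x => (x, x)) (linf_sum Rsp Csp).

Definition antidiag : set (l2 R * l2 R) := [set p | exists x, p = (x, - x)%R].

(* x in l2 is identified with the class of (x, 0), which is that of (0, x). *)
Definition RplusC : matnorm (l2 R) :=
  pull (fun x => (x, 0%R)) (quotient_sp antidiag (l1_sum Rsp Csp)).

End OperatorSpaces.

(** * Complex conjugates and duals *)

Section ConjugateSpace.
Variables (R : realType) (V : lmodType R[i]).

Definition cconj : Type := V.
Definition to_cconj (x : V) : cconj := x.
Definition of_cconj (x : cconj) : V := x.

HB.instance Definition _ := GRing.Zmodule.on cconj.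

Definition cconj_scale (a : R[i]) (x : cconj) : cconj :=
  to_cconj (a^* *: of_cconj x).

Fact cconj_scaleA a b x :
  cconj_scale a (cconj_scale b x) = cconj_scale (a * b) x.
Proof. by rewrite /cconj_scale /of_cconj /to_cconj scalerA rmorphM. Qed.
Fact cconj_scale1 : left_id 1 cconj_scale.
Proof. by move=> x; rewrite /cconj_scale rmorph1 scale1r. Qed.
Fact cconj_scaleDr : right_distributive cconj_scale +%R.
Proof. by move=> a x y; exact: scalerDr. Qed.
Fact cconj_scaleDl x : {morph cconj_scale^~ x : a b / a + b}.
Proof. by move=> a b; rewrite /cconj_scale rmorphD scalerDl. Qed.

HB.instance Definition _ := GRing.Zmodule_isLmodule.Build R[i] cconj
  cconj_scaleA cconj_scale1 cconj_scaleDr cconj_scaleDl.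

Definition conj_sp (N : matnorm R V) : matnorm R cconj := pull of_cconj N.

End ConjugateSpace.

Section Dual.
Variable R : realType.

(* M_k(M_n) = M_(kn) *)
Definition scalar_sp n : matnorm R 'M[R[i]]_n :=
  fun k y => mxopnorm (\mxblock_(i < k, j < k) y i j).

(* M_n(X^* ) = CB(X, M_n); the elements of X^* are the bounded linear maps
   among the functions V -> C. *)
Definition dual_sp (V : lmodType R[i]) (N : matnorm R V) :
    matnorm R (V -> R[i]) :=
  fun n f => cbnorm N (@scalar_sp n) (fun v => \matrix_(i, j) f i j v).

(* The Riesz map x |-> <., x> is linear into the conjugate of the dual. *)
Definition riesz (x : l2 R) : cconj (l2 R -> R[i]) :=
  to_cconj (fun y => l2dot y x).

Definition conj_dual (N : matnorm R (l2 R)) : matnorm R (l2 R) :=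
  pull riesz (conj_sp (dual_sp N)).

End Dual.

(** * Complex interpolation *)

Section MatrixModule.
Variables (R : realType) (V : lmodType R[i]) (n : nat).

Definition mxmod : Type := 'M[V]_n.

HB.instance Definition _ := GRing.Zmodule.on mxmod.

Definition mxmod_scale (a : R[i]) (x : mxmod) : mxmod := map_mx ( *:%R a) x.

Fact mxmod_scaleA a b x :
  mxmod_scale a (mxmod_scale b x) = mxmod_scale (a * b) x.
Proof. by apply/matrixP => i j; rewrite !mxE scalerA. Qed.
Fact mxmod_scale1 : left_id 1 mxmod_scale.
Proof. by move=> x; apply/matrixP => i j; rewrite !mxE scale1r. Qed.
Fact mxmod_scaleDr : right_distributive mxmod_scale +%R.
Proof. by move=> a x y; apply/matrixP => i j; rewrite !mxE scalerDr. Qed.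
Fact mxmod_scaleDl x : {morph mxmod_scale^~ x : a b / a + b}.
Proof. by move=> a b; apply/matrixP => i j; rewrite !mxE scalerDl. Qed.

HB.instance Definition _ := GRing.Zmodule_isLmodule.Build R[i] mxmod
  mxmod_scaleA mxmod_scale1 mxmod_scaleDr mxmod_scaleDl.

End MatrixModule.

Section Interpolation.
Variable R : realType.
Local Open Scope ereal_scope.

(* The norm of the sum X_0 + X_1 of two spaces with the same elements. *)
Definition sum_norm (V : lmodType R[i]) (N0 N1 : V -> \bar R) (x : V) : \bar R :=
  ereal_inf [set N0 y + N1 (x - y)%R | y in setT].

Definition strip (z : R[i]) : Prop := (0 <= complex.Re z <= 1)%R.
Definition open_strip (z : R[i]) : Prop := (0 < complex.Re z < 1)%R.

Definition bounded_on (T V : Type) (N : V -> \bar R) (A : set T) (f : T -> V) :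
    Prop := exists M : R, forall z, A z -> N (f z) <= M%:E.

Definition continuous_on (V : lmodType R[i]) (N : V -> \bar R) (A : set R[i])
    (f : R[i] -> V) : Prop :=
  forall z, A z -> forall e : R, (0 < e)%R -> exists2 d : R, (0 < d)%R &
    forall w, A w -> (normc (w - z) < d)%R -> N (f w - f z)%R < e%:E.

Definition holomorphic_on (V : lmodType R[i]) (N : V -> \bar R)
    (A : set R[i]) (f : R[i] -> V) : Prop :=
  forall z, A z -> exists f' : V, forall e : R, (0 < e)%R ->
    exists2 d : R, (0 < d)%R & forall h : R[i], h != 0%R -> (normc h < d)%R ->
      N (h^-1 *: (f (z + h) - f z) - f')%R < e%:E.

Definition re_line (s : R) : set R[i] := [set z | complex.Re z = s].

Definition calderon_fun (V : lmodType R[i]) (N0 N1 : V -> \bar R)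
    (f : R[i] -> V) : Prop :=
  [/\ bounded_on (sum_norm N0 N1) strip f /\
      continuous_on (sum_norm N0 N1) strip f,
      holomorphic_on (sum_norm N0 N1) open_strip f,
      bounded_on N0 (re_line 0) f /\ continuous_on N0 (re_line 0) f
    & bounded_on N1 (re_line 1) f /\ continuous_on N1 (re_line 1) f].

Definition calderon_norm (V : lmodType R[i]) (N0 N1 : V -> \bar R)
    (f : R[i] -> V) : \bar R :=
  maxe (ereal_sup [set N0 (f z) | z in re_line 0])
       (ereal_sup [set N1 (f z) | z in re_line 1]).

Definition interp_norm (V : lmodType R[i]) (theta : R) (N0 N1 : V -> \bar R)
    (x : V) : \bar R :=
  if theta == 0%R then N0 x else if theta == 1%R then N1 x else
  ereal_inf [set calderon_norm N0 N1 f
            | f in [set f | calderon_fun N0 N1 f /\ f theta%:C = x]].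

Definition interp (V : lmodType R[i]) (theta : R) (X0 X1 : matnorm R V) :
    matnorm R V :=
  fun n x => @interp_norm (mxmod V n) theta (X0 n) (X1 n) x.

End Interpolation.

(** * The quantity kappa_n *)

Section Kappa.
Variable R : realType.

Definition first_col n (e : 'I_n -> l2 R) : 'M[l2 R]_n :=
  \matrix_(i, j) (if j == 0%N :> nat then e i else 0).

(* kappa_n(X) = k, including independence of the orthonormal set. *)
Definition kappa_eq (X : matnorm R (l2 R)) n (k : R) : Prop :=
  forall e : 'I_n -> l2 R, l2_orthonormal e -> X n (first_col e) = k%:E.

End Kappa.

(* Main.v *)
Require Import Defs.
From mathcomp Require Import all_boot all_order all_algebra.
From mathcomp Require Import all_classical all_reals all_analysis.
From HB Require Import structures.
From mathcomp Require Import ring lra.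

Set Implicit Arguments.
Unset Strict Implicit.
Unset Printing Implicit Defensive.

Import Order.TTheory GRing.Theory Num.Theory.
Import numFieldNormedType.Exports.

Local Open Scope classical_set_scope.
Local Open Scope complex_scope.
Local Open Scope ring_scope.

(** Let [x] be the matrix whose first column is [e_1, ..., e_n]. The proof rests
    on the linear functional [diag_mean e], the mean of the numbers [<y_i1,
    e_i>], which takes the value 1 at [x].

    At the left end [kappa_n] is 1. It is at most 1 because the identity from
    the row space [R] is a complete contraction and Bessel's inequality bounds
    the norm of [x] over [R] by 1; dually, [diag_mean e] is a mean of
    contractive functionals. At the right end [kappa_n] is [sqrt n]: a column of
    [n] complete contractions has norm at most [sqrt n], and dually [diag_mean
    e] has norm at most [1 / sqrt n], as one sees by testing an element of the
    conjugate dual on [x], which lies in the unit ball of [X]. For [R + C] and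
    [R \cap C] the same four bounds come from the explicit descriptions of [R]
    and [C]; the lower bound in [R + C] uses the scalars, an operator space by
    [scalar_operator_space], as common target of [R] and [C].

    Since [x] and [diag_mean e] norm each other at both ends, the interpolated
    norm of [x] is the geometric mean of the two values ([interp_norm_line]).
    The function [n ^ ((theta - z) / 2) x] gives the upper bound. For the lower
    bound, let [f] be admissible with [f theta = x]: the scalar function
    [diag_mean (f z) * n ^ (z / 2)] is bounded by the norm of [f] on both
    boundary lines and has modulus [n ^ (theta / 2)] at [theta], so the three
    lines theorem concludes.

    The three lines theorem is derived from pointwise complex differentiability:
    Goursat's theorem on rectangles ([goursat]) shows that the difference
    quotient [(f z - f c) / (z - c)] has zero contour integral; for a function
    with value 1 at [c] and small values on the boundary this contradicts the
    nonzero integral of [1 / (z - c)], and powers of a function reduce the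
    maximum principle ([rectangle_maximum_principle]) to this situation. *)

(** * The complex plane as a normed field *)

Section ComplexPlane.
Variable R : realType.

(** The head [Num.NumField.sort] is what lets unification find the topology and
    the derivatives that every [numFieldType] carries over itself. *)
Definition Cplx : numFieldType := R[i].

Implicit Types (z w h : Cplx) (f g : Cplx -> Cplx).

Lemma complex_ext (z w : R[i]) :
  complex.Re z = complex.Re w -> complex.Im z = complex.Im w -> z = w.
Proof. by case: z w => [? ?] [? ?] /= -> ->. Qed.

Lemma Re_le_normc (z : R[i]) : `|complex.Re z| <= normc z.
Proof.
case: z => a b /=; rewrite -sqrtr_sqr ler_wsqrtr // lerDl; exact: sqr_ge0.
Qed.

Lemma Im_le_normc (z : R[i]) : `|complex.Im z| <= normc z.
Proof.
case: z => a b /=; rewrite -sqrtr_sqr ler_wsqrtr // lerDr; exact: sqr_ge0.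
Qed.

Lemma normc_le_ReIm (z : R[i]) : normc z <= `|complex.Re z| + `|complex.Im z|.
Proof.
case: z => a b /=.
rewrite -(@ler_pXn2r _ 2) ?nnegrE ?sqrtr_ge0 ?addr_ge0//.
rewrite sqr_sqrtr ?addr_ge0 ?sqr_ge0// sqrrD !real_normK ?num_real//.
by rewrite addrAC lerDl mulrn_wge0// mulr_ge0.
Qed.

Lemma gt0_Re_complex (e : Cplx) : 0 < e -> e = (complex.Re e)%:C.
Proof.
by move=> e0; have : (0 : R[i]) < e by []; case: (e : R[i]) => a b;
  rewrite ltcE /= => /andP[/eqP ->].
Qed.

Lemma normc_real (r : R) : normc (r%:C) = `|r|.
Proof. by rewrite /= expr0n addr0 sqrtr_sqr. Qed.

Lemma normcB (z w : R[i]) : normc (z - w) = normc (w - z).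
Proof. by rewrite -(normcN (z - w)) opprB. Qed.

Lemma gt0_complexR (e : R) : ((0 : Cplx) < (e%:C : Cplx)) = (0 < e).
Proof. exact: ltcR. Qed.

Lemma norm_lt_complexR z (e : R) : (`|z| < (e%:C : Cplx)) = (normc z < e).
Proof. exact: (ltcR (normc z)). Qed.

(** The norm of a [numFieldType] is valued in the field, here in [R[i]]; this
    lemma and the next restate continuity and complex differentiability, the
    derivative along [1] over the field [R[i]], with the real modulus. *)
Lemma continuous_normcP f z : {for z, continuous f} <->
  forall e : R, 0 < e -> exists2 d : R, 0 < d &
    forall w, normc (w - z) < d -> normc (f w - f z) < e.
Proof.
split=> [/cvgrPdist_lt cf e e0|cf].
- have /cf /nbhs_ballP[d d0 dP] : (0 : Cplx) < e%:C by rewrite gt0_complexR.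
  have dE := gt0_Re_complex d0.
  exists (complex.Re d); first by move: d0; rewrite /= {1}dE gt0_complexR.
  move=> w wz; rewrite normcB -norm_lt_complexR; apply: (dP w).
  by rewrite /ball/= dE norm_lt_complexR normcB.
- apply/(cvgrPdist_lt (F := nbhs z)) => e e0.
  have eE := gt0_Re_complex e0.
  move: e0; rewrite eE gt0_complexR => e0.
  have [d d0 dP] := cf _ e0.
  apply/nbhs_ballP; exists (d%:C : Cplx); first by rewrite /= gt0_complexR.
  move=> w; rewrite /ball/= norm_lt_complexR => wz.
  by rewrite norm_lt_complexR normcB; apply: dP; rewrite normcB.
Qed.

Lemma derivable_normcP f z : derivable f z 1 <->
  exists f' : Cplx, forall e : R, 0 < e -> exists2 d : R, 0 < d &
    forall h, h != 0 -> normc h < d ->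
      normc (h^-1 * (f (z + h) - f z) - f') < e.
Proof.
rewrite /derivable; split=> [cf|[f' hf]].
- exists (lim (h^-1 *: ((f \o shift z) (h *: 1) - f z) @[h --> 0^'])) => e e0.
  have /cvgrPdist_lt cf' := cf.
  have /cf' /nbhs_ballP[d d0 dP] : (0 : Cplx) < e%:C by rewrite gt0_complexR.
  have dE := gt0_Re_complex d0.
  exists (complex.Re d); first by move: d0; rewrite /= {1}dE gt0_complexR.
  move=> h h0 hd; rewrite normcB -norm_lt_complexR.
  have := dP h; rewrite /ball/= sub0r normrN dE norm_lt_complexR.
  move=> /(_ hd h0); rewrite (_ : h *: 1 = h) ?[h + z]addrC//.
  by rewrite /GRing.scale/= mulr1.
- apply/cvg_ex; exists f'; apply/cvgrPdist_lt => e e0.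
  have eE := gt0_Re_complex e0.
  move: e0; rewrite eE gt0_complexR => e0.
  have [d d0 dP] := hf _ e0.
  apply/nbhs_ballP; exists (d%:C : Cplx); first by rewrite /= gt0_complexR.
  move=> h; rewrite /ball/= sub0r normrN norm_lt_complexR => hd h0.
  rewrite norm_lt_complexR normcB (_ : h *: 1 = h); last first.
    by rewrite /GRing.scale/= mulr1.
  by rewrite [h + z]addrC; apply: dP.
Qed.

Lemma derivable_continuous f z : derivable f z 1 -> {for z, continuous f}.
Proof. by move=> /derivable1_diffP/differentiable_continuous. Qed.

Lemma continuous_horizontal f (x y : R) : {for (x +i* y), continuous f} ->
  {for x, continuous (fun t => complex.Re (f (t +i* y)))} /\
  {for x, continuous (fun t => complex.Im (f (t +i* y)))}.
Proof.
move=> /continuous_normcP cf.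
have H : forall e : R, 0 < e -> \forall t \near x,
  normc (f (t +i* y) - f (x +i* y)) < e.
  move=> e /cf[d d0 dP]; near=> t; apply: dP.
  rewrite /= subrr expr0n addr0 sqrtr_sqr distrC; near: t;
    exact: (nbhsx_ballx x _ d0).
split; apply/cvgrPdist_lt => e /H; apply: filterS => t; apply: le_lt_trans.
  by rewrite distrC (le_trans _ (Re_le_normc _))//; case: (f _) (f _) =>
    [? ?] [].
by rewrite distrC (le_trans _ (Im_le_normc _))//; case: (f _) (f _) => [? ?] [].
Unshelve. all: by end_near. Qed.

Lemma continuous_vertical f (x y : R) : {for (x +i* y), continuous f} ->
  {for y, continuous (fun t => complex.Re (f (x +i* t)))} /\
  {for y, continuous (fun t => complex.Im (f (x +i* t)))}.
Proof.
move=> /continuous_normcP cf.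
have H : forall e : R, 0 < e -> \forall t \near y,
  normc (f (x +i* t) - f (x +i* y)) < e.
  move=> e /cf[d d0 dP]; near=> t; apply: dP.
  rewrite /= subrr expr0n add0r sqrtr_sqr distrC; near: t;
    exact: (nbhsx_ballx y _ d0).
split; apply/cvgrPdist_lt => e /H; apply: filterS => t; apply: le_lt_trans.
  by rewrite distrC (le_trans _ (Re_le_normc _))//; case: (f _) (f _) =>
    [? ?] [].
by rewrite distrC (le_trans _ (Im_le_normc _))//; case: (f _) (f _) => [? ?] [].
Unshelve. all: by end_near. Qed.

End ComplexPlane.

(** * Integrals of complex functions over segments *)

Section ComplexIntegral.
Variable R : realType.
Notation C := (Cplx R).
Notation mu := (@lebesgue_measure R).

Definition cint (a b : R) (g : R -> C) : C :=
  (\int[mu]_(x in `[a, b]) complex.Re (g x))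
    +i* (\int[mu]_(x in `[a, b]) complex.Im (g x)).

Definition cintegrable (a b : R) (g : R -> C) : Prop :=
  mu.-integrable `[a, b] (EFin \o (fun x => complex.Re (g x))) /\
  mu.-integrable `[a, b] (EFin \o (fun x => complex.Im (g x))).

Lemma cintegrable_continuous (a b : R) (g : R -> C) :
  (forall x, a <= x <= b ->
     {for x, continuous (fun t => complex.Re (g t))} /\
     {for x, continuous (fun t => complex.Im (g t))}) ->
  cintegrable a b g.
Proof.
move=> cg; split; apply: continuous_compact_integrable => //.
- exact: segment_compact.
- by apply: continuous_in_subspaceT => x; rewrite inE /= in_itv => /cg[].
- exact: segment_compact.
- by apply: continuous_in_subspaceT => x; rewrite inE /= in_itv => /cg[].
Qed.

Lemma eq_cint a b (f g : R -> C) : (forall x, a <= x <= b -> f x = g x) ->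
  cint a b f = cint a b g.
Proof.
by move=> fg; rewrite /cint; congr (_ +i* _); apply: eq_Rintegral => x;
  rewrite inE /= in_itv => /fg ->.
Qed.

Lemma cintB a b (f g : R -> C) : cintegrable a b f -> cintegrable a b g ->
  cint a b (fun x => f x - g x) = cint a b f - cint a b g.
Proof.
move=> [fr fi] [gr gi].
transitivity ((\int[mu]_(x in `[a, b]) (complex.Re (f x) - complex.Re (g x)))
    +i* (\int[mu]_(x in `[a, b]) (complex.Im (f x) - complex.Im (g x))) : C).
  by congr (_ +i* _); apply: eq_Rintegral => x _; case: (g x) (f x) => ? ? [].
by rewrite !RintegralB.
Qed.

Lemma cint_cst a b (c : C) : a <= b -> cint a b (fun=> c) = c * (b - a)%:C.
Proof.
move=> ab; rewrite /cint !Rintegral_cst//= lebesgue_measure_itv/= lte_fin.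
have -> : fine (if (a < b)%R then b%:E - a%:E else 0)%E = b - a.
  by move: ab; rewrite le_eqVlt => /predU1P[->|->]//=; rewrite ltxx subrr.
by case: c => c d; apply: complex_ext; rewrite /= !mulr0 ?subr0 ?add0r.
Qed.

Lemma cint_split a m b (g : R -> C) : a <= m <= b -> cintegrable a b g ->
  cint a b g = cint a m g + cint m b g.
Proof.
move=> /andP[am mb] [gr gi].
have S (h : R -> R) : mu.-integrable `[a, b] (EFin \o h) ->
    \int[mu]_(x in `[a, b]) h x
      = \int[mu]_(x in `[a, m]) h x + \int[mu]_(x in `[m, b]) h x.
  move=> hi; rewrite -(@Rintegral_itv_obnd_cbnd _ m); last first.
    by apply: integrableS hi => //; apply: subset_itv; rewrite bnd_simp.
  by rewrite -(@Rintegral_itvB _ _ (BLeft a) (BRight b))//; rewrite addrC subrK.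
by rewrite /cint !S.
Qed.

(** The factor 2 comes from bounding the two parts separately. It is harmless:
    the maximum principle below is insensitive to constants. *)
Lemma normc_cint_le a b (g : R -> C) (M : R) : a <= b ->
  cintegrable a b g -> (forall x, a <= x <= b -> normc (g x) <= M) ->
  normc (cint a b g) <= 2 * M * (b - a).
Proof.
move=> ab [gr gi] gM.
have B (h : R -> R) : mu.-integrable `[a, b] (EFin \o h) ->
    (forall x, a <= x <= b -> `|h x| <= M) ->
    `|\int[mu]_(x in `[a, b]) h x| <= M * (b - a).
  move=> hi hM; apply: (le_trans (le_normr_Rintegral _ hi));
    first exact: measurable_itv.
  apply: (@le_trans _ _ (\int[mu]_(x in `[a, b]) M)).
    apply: le_Rintegral => //; first exact: integrable_norm hi.
    by apply: continuous_compact_integrable; [exact: segment_compact|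
        apply: continuous_subspaceT => x; exact: cvg_cst].
  rewrite Rintegral_cst//= lebesgue_measure_itv/= lte_fin.
  by move: ab; rewrite le_eqVlt => /predU1P[->|->]//=;
    rewrite ltxx subrr !mulr0.
apply: (le_trans (normc_le_ReIm _)).
rewrite -mulrA mulr2n mulrDl mul1r; apply: lerD; apply: B => // x /gM;
  apply: le_trans.
  exact: Re_le_normc.
exact: Im_le_normc.
Qed.

End ComplexIntegral.

(** * Contour integrals over rectangles *)

Section Contour.
Variable R : realType.
Notation C := (Cplx R).
Implicit Types (a b s t : R) (f g : C -> C).

Definition in_rect a b s t (z : C) : Prop :=
  a <= complex.Re z <= b /\ s <= complex.Im z <= t.

Definition continuous_on_rect a b s t f : Prop :=
  forall z, in_rect a b s t z -> {for z, continuous f}.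

(** The counterclockwise integral of [f(z) dz] over the boundary, with opposite
    sides paired. *)
Definition contour a b s t f : C :=
  (cint a b (fun x => f (x +i* s)) - cint a b (fun x => f (x +i* t)))
  + 'i * (cint s t (fun y => f (b +i* y)) - cint s t (fun y => f (a +i* y))).

Lemma cintegrable_horizontal a b s t f :
  continuous_on_rect a b s t f ->
  forall y, s <= y <= t -> cintegrable a b (fun x => f (x +i* y)).
Proof.
move=> cf y sy; apply: cintegrable_continuous => x ax.
by apply: (@continuous_horizontal _ f); apply: cf.
Qed.

Lemma cintegrable_vertical a b s t f :
  continuous_on_rect a b s t f ->
  forall x, a <= x <= b -> cintegrable s t (fun y => f (x +i* y)).
Proof.
move=> cf x ax; apply: cintegrable_continuous => y sy.
by apply: (@continuous_vertical _ f); apply: cf.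
Qed.

Lemma contour_split_Re a m b s t f : a <= m <= b -> s <= t ->
  continuous_on_rect a b s t f ->
  contour a b s t f = contour a m s t f + contour m b s t f.
Proof.
move=> amb st cf; rewrite /contour.
have hs := cintegrable_horizontal cf.
rewrite (cint_split amb (hs s _)) ?lexx ?st// (cint_split amb (hs t _)) ?lexx
  ?st//.
by ring.
Qed.

Lemma contour_split_Im a b s m t f : a <= b -> s <= m <= t ->
  continuous_on_rect a b s t f ->
  contour a b s t f = contour a b s m f + contour a b m t f.
Proof.
move=> ab smt cf; rewrite /contour.
have hs := cintegrable_vertical cf.
rewrite (cint_split smt (hs a _)) ?lexx ?ab// (cint_split smt (hs b _)) ?lexx
  ?ab//.
by ring.
Qed.

Lemma contourB a b s t f g : a <= b -> s <= t ->
  continuous_on_rect a b s t f -> continuous_on_rect a b s t g ->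
  contour a b s t (fun z => f z - g z) = contour a b s t f - contour a b s t g.
Proof.
move=> ab st cf cg; rewrite /contour.
have [hf hg] := (cintegrable_horizontal cf, cintegrable_horizontal cg).
have [vf vg] := (cintegrable_vertical cf, cintegrable_vertical cg).
rewrite !cintB ?(hf s, hf t, hg s, hg t, vf a, vf b, vg a,
  vg b) ?lexx ?ab ?st//.
all: try by (apply: hf; rewrite lexx ?st) || (apply: hg; rewrite lexx ?st)
  || (apply: vf; rewrite lexx ?ab) || (apply: vg; rewrite lexx ?ab).
by ring.
Qed.

(** On paired sides an affine function differs by a constant, so that the two
    pairs contribute opposite multiples of the area. *)
Lemma contour_affine a b s t (u v : C) : a <= b -> s <= t ->
  continuous_on_rect a b s t (fun z => u + v * z) ->
  contour a b s t (fun z => u + v * z) = 0.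
Proof.
move=> ab st cf; rewrite /contour.
have h := cintegrable_horizontal cf; have v' := cintegrable_vertical cf.
rewrite -!cintB ?h ?v' ?lexx ?ab ?st//; last first.
all: try by (apply: h; rewrite lexx ?st) || (apply: v'; rewrite lexx ?ab).
rewrite (@eq_cint _ a b _ (fun=> v * (0 +i* (s - t)))); last first.
  move=> x _; rewrite opprD addrACA subrr add0r -mulrBr; congr (_ * _).
  by apply: complex_ext; rewrite /= ?subrr.
rewrite (@eq_cint _ s t _ (fun=> v * ((b - a) +i* 0))); last first.
  move=> x _; rewrite opprD addrACA subrr add0r -mulrBr; congr (_ * _).
  by apply: complex_ext; rewrite /= ?subrr.
rewrite !cint_cst// -[X in X + _]mulrA ['i * _]mulrC -[X in _ + X]mulrA -[X in
  _ + X]mulrA -mulrDr.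
rewrite [X in _ * X](_ : _ = 0) ?mulr0//.
by apply: complex_ext => /=; ring.
Qed.

Lemma normc_contour_le a b s t f (M : R) : a <= b -> s <= t ->
  continuous_on_rect a b s t f ->
  (forall x, a <= x <= b ->
     normc (f (x +i* s)) <= M /\ normc (f (x +i* t)) <= M) ->
  (forall y, s <= y <= t ->
     normc (f (a +i* y)) <= M /\ normc (f (b +i* y)) <= M) ->
  normc (contour a b s t f) <= 4 * M * ((b - a) + (t - s)).
Proof.
move=> ab st cf hM vM; rewrite /contour.
have h := cintegrable_horizontal cf; have v := cintegrable_vertical cf.
apply: (le_trans (le_normcD _ _)).
rewrite Normc.normcM (_ : normc 'i = 1); last by rewrite /= expr0n add0r expr1n
  sqrtr1.
rewrite mul1r.
have H y : s <= y <= t -> (forall x, a <= x <= b -> normc (f (x +i* y)) <= M) ->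
    normc (cint a b (fun x => f (x +i* y))) <= 2 * M * (b - a).
  by move=> sy Hy; apply: normc_cint_le => //; apply: h.
have V x : a <= x <= b -> (forall y, s <= y <= t -> normc (f (x +i* y)) <= M) ->
    normc (cint s t (fun y => f (x +i* y))) <= 2 * M * (t - s).
  by move=> sy Hy; apply: normc_cint_le => //; apply: v.
have Hs := H s _ (fun x ax => (hM x ax).1); have Ht := H t _ (fun x ax =>
  (hM x ax).2).
have Va := V a _ (fun x ax => (vM x ax).1); have Vb := V b _ (fun x ax =>
  (vM x ax).2).
apply: (@le_trans _ _ ((2 * M * (b - a) + 2 * M * (b - a)) + (2 * M * (t - s) +
  2 * M * (t - s)))).
  apply: lerD; apply: (le_trans (le_normcD _ _)); rewrite normcN; apply: lerD.
  - by apply: Hs; rewrite lexx.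
  - by apply: Ht; rewrite lexx andbT.
  - by apply: Vb; rewrite lexx andbT.
  - by apply: Va; rewrite lexx.
by rewrite le_eqVlt; apply/orP; left; apply/eqP; ring.
Qed.

End Contour.

(** * Complex differentiability of pointwise operations *)

Section PointwiseDerivable.
Variable R : realType.
Notation C := (Cplx R).
Implicit Types (f g : C -> C) (z : C).

Lemma derivable_funD f g z : derivable f z 1 -> derivable g z 1 ->
  derivable (fun w => f w + g w) z 1.
Proof.
move=> df dg; have h := derivableD df dg.
by have -> : (fun w => f w + g w) = f + g by apply/funext.
Qed.

Lemma derivable_funB f g z : derivable f z 1 -> derivable g z 1 ->
  derivable (fun w => f w - g w) z 1.
Proof.
move=> df dg; have h := derivableB df dg.
by have -> : (fun w => f w - g w) = f - g by apply/funext.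
Qed.

Lemma derivable_funM f g z : derivable f z 1 -> derivable g z 1 ->
  derivable (fun w => f w * g w) z 1.
Proof.
move=> df dg; have h := derivableM df dg.
by have -> : (fun w => f w * g w) = f * g by apply/funext.
Qed.

Lemma derivable_funX f n z : derivable f z 1 ->
  derivable (fun w => f w ^+ n) z 1.
Proof.
move=> df; elim: n => [|n IH]; first exact: derivable_cst.
have h := derivable_funM df IH.
have -> // : (fun w => f w ^+ n.+1) = (fun w => f w * f w ^+ n).
by apply/funext => w; rewrite exprS.
Qed.

Lemma derivable_funV f z : f z != 0 -> derivable f z 1 ->
  derivable (fun w => (f w)^-1) z 1.
Proof. by move=> f0 df; have h := derivableV f0 df. Qed.

End PointwiseDerivable.

(** * Goursat's theorem *)

Section Goursat.
Variable R : realType.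
Notation C := (Cplx R).
Implicit Types (a b s t : R) (f g : C -> C).

Lemma continuous_affine (u v : C) z :
  {for z, continuous (fun w : C => u + v * w)}.
Proof.
apply: derivable_continuous.
apply: (@derivableD C C C (cst u) (fun w => v * w)); first exact: derivable_cst.
by apply: (@derivableM C C (cst v) id);
  [exact: derivable_cst|exact: derivable_id].
Qed.

Lemma continuous_on_rectS a b s t a' b' s' t' f :
  a <= a' -> b' <= b -> s <= s' -> t' <= t ->
  continuous_on_rect a b s t f -> continuous_on_rect a' b' s' t' f.
Proof.
move=> aa bb ss tt cf z [/andP[a1 a2] /andP[a3 a4]]; apply: cf; split;
  apply/andP; split.
- exact: le_trans aa a1.
- exact: le_trans a2 bb.
- exact: le_trans ss a3.
- exact: le_trans a4 tt.
Qed.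

Lemma dist_in_interval (x d u v : R) : x <= u <= x + d -> x <= v <= x + d ->
  `|v - u| <= d.
Proof.
by move=> /andP[u1 u2] /andP[v1 v2]; rewrite ler_norml; apply/andP; split; lra.
Qed.

Lemma normcD3_le (z1 z2 z3 z4 : R[i]) :
  normc (z1 + z2 + (z3 + z4)) <= normc z1 + normc z2 + (normc z3 + normc z4).
Proof.
apply: (le_trans (le_normcD _ _)); apply: lerD; exact: le_normcD.
Qed.

(** The integrals over the four quarters add up to the whole, hence one of them
    has at least a quarter of its modulus. *)
Lemma contour_quarter x y (w h : R) f (e : R) : 0 <= w -> 0 <= h ->
  continuous_on_rect x (x + w) y (y + h) f ->
  e <= normc (contour x (x + w) y (y + h) f) ->
  exists x' y', [/\ x <= x' <= x + w / 2, y <= y' <= y + h / 2 &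
    e / 4 <= normc (contour x' (x' + w / 2) y' (y' + h / 2) f)].
Proof.
move=> w0 h0 cf ef; apply: contrapT => no.
have small x' y' : x <= x' <= x + w / 2 -> y <= y' <= y + h / 2 ->
    normc (contour x' (x' + w / 2) y' (y' + h / 2) f) < e / 4.
  by move=> hx hy; rewrite ltNge; apply/negP => hc; apply: no; exists x', y'.
have w2 : x + w = x + w / 2 + w / 2 by field.
have h2 : y + h = y + h / 2 + h / 2 by field.
move: ef; rewrite w2 h2 => ef; rewrite w2 h2 in cf.
have cf1 : continuous_on_rect x (x + w / 2) y (y + h / 2 + h / 2) f.
  by apply: continuous_on_rectS cf; rewrite ?lexx//; lra.
have cf2 : continuous_on_rect (x + w / 2) (x + w / 2 + w / 2) y (y + h / 2 + h
  / 2) f.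
  by apply: continuous_on_rectS cf; rewrite ?lexx//; lra.
move: ef; apply/negP; rewrite -ltNge.
rewrite (@contour_split_Re _ x (x + w / 2)) //; [|lra|lra].
rewrite (@contour_split_Im _ x _ y (y + h / 2)) //; [|lra|lra].
rewrite (@contour_split_Im _ (x + w / 2) _ y (y + h / 2)) //; [|lra|lra].
apply: (le_lt_trans (normcD3_le _ _ _ _)).
have s1 := small x y; have s2 := small x (y + h / 2).
have s3 := small (x + w / 2) y; have s4 := small (x + w / 2) (y + h / 2).
have -> : e = e / 4 + e / 4 + (e / 4 + e / 4) by field.
have wx : x <= x + w / 2 by rewrite lerDl divr_ge0.
have hy : y <= y + h / 2 by rewrite lerDl divr_ge0.
by apply: ltrD; apply: ltrD; [apply: s1|apply: s2|apply: s3|apply: s4];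
  rewrite ?lexx ?wx ?hy.
Qed.

Lemma nested_intervals (x : nat -> R) (w : R) : 0 <= w ->
  (forall k, x k <= x k.+1 <= x k + w / 2 ^+ k.+1) ->
  exists p, forall k, x k <= p <= x k + w / 2 ^+ k.
Proof.
move=> w0 hx.
have up n k : x k <= x (k + n)%N.
  elim: n => [|n IH]; rewrite ?addn0 // addnS; apply: (le_trans IH).
  by have /andP[] := hx (k + n)%N.
have dn n k : x (k + n)%N + w / 2 ^+ (k + n) <= x k + w / 2 ^+ k.
  elim: n => [|n IH]; rewrite ?addn0 // addnS; apply: le_trans IH.
  have /andP[_ h] := hx (k + n)%N.
  have -> : w / 2 ^+ (k + n) = w / 2 ^+ (k + n).+1 + w / 2 ^+ (k + n).+1.
    by rewrite exprS; field; rewrite expf_neq0.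
  by rewrite addrA lerD2r.
have pos k : 0 <= w / 2 ^+ k by rewrite divr_ge0 ?exprn_ge0.
have le j k : x j <= x k + w / 2 ^+ k.
  have [jk|kj] := leqP j k.
    by have := up (k - j)%N j; rewrite subnKC// => /le_trans; apply;
      rewrite lerDl.
  have := dn (j - k)%N k; rewrite (subnKC (ltnW kj)); apply: le_trans.
  by rewrite lerDl.
have hs : has_sup (range x).
  split; first by exists (x 0%N), 0%N.
  by exists (x 0%N + w / 2 ^+ 0); move=> _ [j _ <-].
exists (sup (range x)) => k; apply/andP; split.
  by apply: ub_le_sup; [exact: hs.2|exists k].
by apply: sup_le_ub; [exact: hs.1|move=> _ [j _ <-]].
Qed.

(** Bisection: if the integral had modulus [e > 0], nested rectangles shrinking
    to a point [p] would have integrals of modulus at least [e / 4 ^ k]. Near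
    [p] the function is affine up to an error small compared with the diameter
    [S / 2 ^ k]; the affine part integrates to zero and the error, over a
    perimeter of order [2 ^- k], to something smaller than [e / 4 ^ k]. *)
Theorem goursat a b s t f : a <= b -> s <= t ->
  (forall z, in_rect a b s t z -> derivable f z 1) ->
  contour a b s t f = 0.
Proof.
move=> ab st df; apply: contrapT => nz.
have cf : continuous_on_rect a b s t f by move=> z /df/derivable_continuous.
set e := normc (contour a b s t f).
have e0 : 0 < e.
  rewrite lt_neqAle normc_ge0 andbT eq_sym; apply/eqP => /Normc.eq0_normc.
  exact: nz.
set w := b - a; set h := t - s.
have w0 : 0 <= w by rewrite subr_ge0.
have h0 : 0 <= h by rewrite subr_ge0.
pose P (k : nat) (p : R * R) := [/\ a <= p.1, p.1 + w / 2 ^+ k <= b, s <= p.2,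
  p.2 + h / 2 ^+ k <= t &
  e / 4 ^+ k <= normc (contour p.1 (p.1 + w / 2 ^+ k) p.2 (p.2 + h / 2 ^+ k)
    f)].
have P0 : P 0%N (a, s).
  by split => //=; rewrite ?divr1 ?expr0 ?divr1 /w /h ?subrKC // addrC subrK.
have Pstep k p : P k p -> exists q, P k.+1 q /\
    (p.1 <= q.1 <= p.1 + w / 2 ^+ k.+1) /\ (p.2 <= q.2 <= p.2 + h / 2 ^+ k.+1).
  move=> [p1 p2 p3 p4 p5].
  have k2 : 0 < 2 ^+ k :> R by rewrite exprn_gt0.
  have wk : 0 <= w / 2 ^+ k by rewrite divr_ge0 // ltW.
  have hk : 0 <= h / 2 ^+ k by rewrite divr_ge0 // ltW.
  have cfk := continuous_on_rectS p1 p2 p3 p4 cf.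
  have [x' [y' [hx hy he]]] := contour_quarter wk hk cfk p5.
  have W (v : R) : v / 2 ^+ k / 2 = v / 2 ^+ k.+1 by rewrite exprSr invfM mulrA.
  have W2 (v : R) : v / 2 ^+ k = v / 2 ^+ k.+1 + v / 2 ^+ k.+1 by rewrite -W;
    field.
  rewrite !W in hx hy he.
  exists (x', y'); split; last by split.
  rewrite W2 addrA in p2; rewrite W2 addrA in p4.
  case/andP: hx => hx1 hx2; case/andP: hy => hy1 hy2.
  split => /=.
  - exact: le_trans p1 hx1.
  - by apply: le_trans p2; rewrite lerD2r.
  - exact: le_trans p3 hy1.
  - by apply: le_trans p4; rewrite lerD2r.
  - by apply: le_trans he; rewrite exprSr invfM mulrA.
pose next k (p : {p | P k p}) : {p | P k.+1 p} :=
  exist _ (sval (cid (Pstep k _ (svalP p)))) (svalP (cid (Pstep k _ (svalP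
    p)))).1.
pose sq := fix sq k : {p | P k p} :=
  if k is k'.+1 then next k' (sq k') else exist _ (a, s) P0.
have sqS k : ((sval (sq k)).1 <= (sval (sq k.+1)).1 <= (sval (sq k)).1 + w / 2
  ^+ k.+1) /\
    ((sval (sq k)).2 <= (sval (sq k.+1)).2 <= (sval (sq k)).2 + h / 2 ^+ k.+1).
  exact: (svalP (cid (Pstep k _ (svalP (sq k))))).2.
have [X hX] := nested_intervals w0 (fun k => (sqS k).1).
have [Y hY] := nested_intervals h0 (fun k => (sqS k).2).
pose p : C := X +i* Y.
have pin : in_rect a b s t p.
  have := hX 0%N; have := hY 0%N => /=; rewrite expr0 !divr1 /w /h.
  by rewrite !subrKC.
have /derivable_normcP[f' hf'] := df _ pin.
set S := w + h.
have S21 : 0 < S ^+ 2 + 1 by rewrite ltr_wpDl ?sqr_ge0.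
have S0 : 0 <= S by rewrite addr_ge0.
(* This accuracy makes the final bound at most half of e / 4 ^ k; adding 1 to
   S ^ 2 covers the degenerate rectangle. *)
have d1 : 0 < e / (8 * (S ^+ 2 + 1)).
  by rewrite divr_gt0 // mulr_gt0 // ltr_wpDl ?sqr_ge0.
have [d d0 hd] := hf' _ d1.
have [k hk] : exists k : nat, S / 2 ^+ k < d.
  have [k hk] : exists k : nat, S / d < k%:R.
    by exists (Num.bound (S / d)); apply: archi_boundP; rewrite divr_ge0 // ltW.
  exists k; rewrite ltr_pdivrMr ?exprn_gt0// mulrC -ltr_pdivrMr//.
  by apply: (lt_trans hk); rewrite -natrX ltr_nat ltn_expl.
case: (svalP (sq k)) => q1 q2 q3 q4 q5.
set x := (sval (sq k)).1 in q1 q2 q5; set y := (sval (sq k)).2 in q3 q4 q5.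
have kp : 0 < 2 ^+ k :> R by rewrite exprn_gt0.
have wk : 0 <= w / 2 ^+ k by rewrite divr_ge0 // ltW.
have hk0 : 0 <= h / 2 ^+ k by rewrite divr_ge0 // ltW.
have xw : x <= x + w / 2 ^+ k by rewrite lerDl.
have yh : y <= y + h / 2 ^+ k by rewrite lerDl.
have hXk := hX k; have hYk := hY k; rewrite -/x in hXk; rewrite -/y in hYk.
have cfk : continuous_on_rect x (x + w / 2 ^+ k) y (y + h / 2 ^+ k) f.
  exact: continuous_on_rectS cf.
pose g (z : C) : C := (f p - f' * p) + f' * z.
have cg : continuous_on_rect x (x + w / 2 ^+ k) y (y + h / 2 ^+ k) g.
  by move=> z _; exact: continuous_affine.
have Dfg : contour x (x + w / 2 ^+ k) y (y + h / 2 ^+ k) (fun z => f z - g z)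
    = contour x (x + w / 2 ^+ k) y (y + h / 2 ^+ k) f.
  by rewrite contourB// /g contour_affine ?subr0.
have cfg : continuous_on_rect x (x + w / 2 ^+ k) y (y + h / 2 ^+ k) (fun z =>
  f z - g z).
  by move=> z hz; exact: (cvgB (cfk z hz) (cg z hz)).
have small (z : C) : in_rect x (x + w / 2 ^+ k) y (y + h / 2 ^+ k) z ->
    normc (f z - g z) <= e / (8 * (S ^+ 2 + 1)) * (S / 2 ^+ k).
  move=> [/andP[z1 z2] /andP[z3 z4]].
  have zp : normc (z - p) <= S / 2 ^+ k.
    apply: (le_trans (normc_le_ReIm _)); rewrite /S mulrDl.
    case: (z) z1 z2 z3 z4 => u v /= z1 z2 z3 z4.
    by apply: lerD; [apply: (dist_in_interval (v := u) hXk)|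
      apply: (dist_in_interval (v := v) hYk)]; apply/andP; split.
  have [->|zn] := eqVneq z p.
    by rewrite /g subrK subrr Normc.normc0 mulr_ge0 ?divr_ge0// ltW// mulr_gt0.
  have zn0 : z - p != 0 by rewrite subr_eq0.
  have := hd (z - p) zn0 (le_lt_trans zp hk).
  rewrite subrKC => /ltW hz.
  have -> : f z - g z = ((z - p)^-1 * (f z - f p) - f') * (z - p).
    by rewrite /g; field.
  by rewrite Normc.normcM; apply: ler_pM => //; exact: normc_ge0.
have := normc_contour_le xw yh cfg (M := e / (8 * (S ^+ 2 + 1)) * (S / 2 ^+ k)).
rewrite Dfg => /(_ _ _)-H.
have : e / 4 ^+ k <= 4 * (e / (8 * (S ^+ 2 + 1)) * (S / 2 ^+ k)) * (S / 2 ^+ k).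
  apply: (le_trans q5); have -> : S / 2 ^+ k = (x + w / 2 ^+ k - x) + (y + h /
    2 ^+ k - y).
    by rewrite /S; ring.
  rewrite {1}(_ : (x + w / 2 ^+ k - x) + (y + h / 2 ^+ k - y) = S / 2 ^+ k);
    last by rewrite /S; ring.
  apply: H.
    by move=> u hu; split; apply: small; split => //=; rewrite lexx ?yh ?andbT.
  by move=> u hu; split; apply: small; split => //=; rewrite lexx ?xw ?andbT.
have -> : 4 ^+ k = 2 ^+ k * 2 ^+ k :> R by rewrite -exprMn; congr (_ ^+ _);
  ring.
have -> : 4 * (e / (8 * (S ^+ 2 + 1)) * (S / 2 ^+ k)) * (S / 2 ^+ k)
    = e / (2 ^+ k * 2 ^+ k) * (S ^+ 2 / (2 * (S ^+ 2 + 1))).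
  by field; rewrite (gt_eqF kp) (gt_eqF S21).
rewrite -{1}[_ / (_ * _)]mulr1 ler_pM2l; last by rewrite divr_gt0 // mulr_gt0.
apply/negP; rewrite -ltNge ltr_pdivrMr ?mulr_gt0// mul1r.
move: (sqr_ge0 S).
by move: (S ^+ 2) => u; clear; lra.
Qed.

End Goursat.

(** * The maximum principle on rectangles *)

Section MaximumPrinciple.
Variable R : realType.
Notation C := (Cplx R).
Notation mu := (@lebesgue_measure R).
Implicit Types (a b s t : R) (f g : C -> C).

(** The value [l] at [c] is meant to be the derivative of [f] there, which makes
    the quotient continuous. *)
Definition diffquot (c l : C) f (z : C) : C :=
  if z == c then l else (z - c)^-1 * (f z - f c).

Lemma derivable_diffquot c l f z : z != c -> derivable f z 1 ->
  derivable (diffquot c l f) z 1.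
Proof.
move=> zc df.
apply: (@near_eq_derivable C C C (fun w => (w - c)^-1 * (f w - f c))).
- near=> w; rewrite /diffquot ifF //; apply/negbTE; rewrite -subr_eq0.
  near: w; apply: (@cvgr_neq0 C C _ (nbhs z) _ (fun w => w - c) (z - c)).
    by apply: cvgB; [exact: cvg_id|exact: cvg_cst].
  by rewrite subr_eq0.
- apply: derivable_funM.
    apply: derivable_funV; first by rewrite subr_eq0.
    by apply: derivable_funB; [exact: derivable_id|exact: derivable_cst].
  by apply: derivable_funB; [exact: df|exact: derivable_cst].
Unshelve. all: by end_near. Qed.

Lemma diffquot_near c f : derivable f c 1 -> exists l : C,
  forall e : R, 0 < e -> exists2 d : R, 0 < d &
    forall z, normc (z - c) < d -> normc (diffquot c l f z - l) < e.
Proof.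
move=> /derivable_normcP[l hl]; exists l => e e0; have [d d0 hd] := hl e e0.
exists d => // z zd; rewrite /diffquot; case: eqVneq => [_|zc].
  by rewrite subrr Normc.normc0.
have := hd (z - c); rewrite subrKC; apply => //; by rewrite subr_eq0.
Qed.

(** The quotient need not be differentiable at the centre, so the rectangle is
    cut along the sides of a small square around it: the other pieces vanish by
    Goursat's theorem, and the square contributes at most a constant times its
    side, the quotient being bounded. *)
Lemma contour_diffquot a b s t (c1 c2 : R) f : a < c1 < b -> s < c2 < t ->
  (forall z, in_rect a b s t z -> derivable f z 1) ->
  exists l, continuous_on_rect a b s t (diffquot (c1 +i* c2) l f) /\
    contour a b s t (diffquot (c1 +i* c2) l f) = 0.
Proof.
move=> /andP[ac cb] /andP[sc ct] df; set c : C := c1 +i* c2.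
have dfc : derivable f c 1 by apply: df; split; rewrite /= !ltW.
have [l hl] := diffquot_near dfc.
exists l; set q := diffquot c l f.
have dq (z : C) : in_rect a b s t z -> z != c -> derivable q z 1.
  by move=> hz zc; exact: (@derivable_diffquot c l f z zc (df z hz)).
have cq : continuous_on_rect a b s t q.
  move=> z hz; have [->|zc] := eqVneq z c; last exact/derivable_continuous/dq.
  by apply/continuous_normcP; rewrite {2}/q/diffquot eqxx.
split=> //.
have [d d0 hd] := hl 1 ltr01.
have small (e : R) : 0 < e -> e < d / 2 -> a <= c1 - e -> c1 + e <= b ->
    s <= c2 - e -> c2 + e <= t ->
    normc (contour a b s t q) <= 16 * (normc l + 1) * e.
  move=> e0 ed h1 h2 h3 h4.
  have ee1 : c1 - e <= c1 + e by clear -e0; lra.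
  have ee2 : c2 - e <= c2 + e by clear -e0; lra.
  have ltm x : x - e < x by rewrite ltrBlDr ltrDl.
  have ltp x : x < x + e by rewrite ltrDl.
  have sub a' b' s' t' : a <= a' -> b' <= b -> s <= s' -> t' <= t ->
      continuous_on_rect a' b' s' t' q.
    by move=> *; exact: continuous_on_rectS cq.
  have zero a' b' s' t' : a <= a' -> b' <= b -> s <= s' -> t' <= t ->
      a' <= b' -> s' <= t' -> b' < c1 \/ c1 < a' \/ t' < c2 \/ c2 < s' ->
      contour a' b' s' t' q = 0.
    move=> p1 p2 p3 p4 p5 p6 out; apply: (goursat p5 p6) =>
      z [/andP[z1 z2] /andP[z3 z4]].
    have hz : in_rect a b s t z.
      by split; apply/andP; split;
      [exact: le_trans z1|exact: le_trans p2|exact: le_trans z3|exact: le_trans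
        p4].
    apply: (dq z hz); apply/eqP => zc; move: z1 z2 z3 z4 out; rewrite zc /=.
    by clear; move=> z1 z2 z3 z4 [|[|[|]]]; rewrite ltNge ?z1 ?z2 ?z3 ?z4.
  have st : s <= t by exact/ltW/(lt_trans sc).
  have l1 : c1 - e <= b by exact: le_trans ee1 h2.
  have l2 : c2 - e <= t by exact: le_trans ee2 h4.
  have r1 : a <= c1 + e by exact: le_trans ee1.
  have r2 : s <= c2 + e by exact: le_trans ee2.
  have s1 := sub _ _ _ _ h1 (lexx b) (lexx s) (lexx t).
  have s2 := sub _ _ _ _ h1 h2 (lexx s) (lexx t).
  have s3 := sub _ _ _ _ h1 h2 h3 (lexx t).
  rewrite (contour_split_Re (introT andP (conj h1 l1)) st cq).
  rewrite (contour_split_Re (introT andP (conj ee1 h2)) st s1).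
  rewrite (zero a (c1 - e)) //; last by left; exact: ltm.
  rewrite (zero (c1 + e) b) //; last by right; left; exact: ltp.
  rewrite (contour_split_Im ee1 (introT andP (conj h3 l2)) s2).
  rewrite (contour_split_Im ee1 (introT andP (conj ee2 h4)) s3).
  rewrite (zero _ _ s (c2 - e)) //; last by right; right; left; exact: ltm.
  rewrite (zero _ _ (c2 + e) t) //; last by right; right; right; exact: ltp.
  rewrite !add0r !addr0.
  have bd z : normc (z - c) < d -> normc (q z) <= normc l + 1.
    move=> /hd /ltW h; rewrite -[q z](subrK l) addrC.
    by apply: (le_trans (le_normcD _ _)); rewrite lerD2l.
  have near1 (x y : R) : c1 - e <= x <= c1 + e -> c2 - e <= y <= c2 + e ->
      normc (q (x +i* y)) <= normc l + 1.
    move=> /andP[x1 x2] /andP[y1 y2]; apply: bd;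
      apply: (le_lt_trans (normc_le_ReIm _)).
    have -> : d = d / 2 + d / 2 by field.
    apply: ltrD; apply: le_lt_trans ed; rewrite /= ler_norml.
      by clear -x1 x2; apply/andP; split; lra.
    by clear -y1 y2; apply/andP; split; lra.
  have cqe := sub _ _ _ _ h1 h2 h3 h4.
  apply: (le_trans (normc_contour_le (M := normc l + 1) ee1 ee2 cqe _ _)).
  - by move=> x hx; split; apply: near1; rewrite // lexx ?ee2 ?andbT.
  - by move=> y hy; split; apply: near1; rewrite // lexx ?ee1 ?andbT.
  by rewrite le_eqVlt; apply/orP; left; apply/eqP; ring.
apply: Normc.eq0_normc; apply/eqP; rewrite eq_le normc_ge0 andbT.
apply/ler_addgt0Pr => k k0; rewrite add0r.
set K := 16 * (normc l + 1).
have K0 : 0 < K by rewrite mulr_gt0 // ltr_wpDl ?normc_ge0.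
pose e := Num.min (Num.min (d / 4) (k / K)) (Num.min (Num.min (c1 - a) (b -
  c1)) (Num.min (c2 - s) (t - c2))).
have e0 : 0 < e by rewrite !lt_min !subr_gt0 ac cb sc ct !divr_gt0.
have : e <= e by [].
rewrite {2}/e !le_min => /andP[/andP[i1 i2] /andP[/andP[i3 i4] /andP[i5 i6]]].
have d4 : d / 4 < d / 2 by clear -d0; lra.
have := small e e0 (le_lt_trans i1 d4).
have h1 : a <= c1 - e by rewrite lerBrDr -lerBrDl.
have h2 : c1 + e <= b by rewrite -lerBrDl.
have h3 : s <= c2 - e by rewrite lerBrDr -lerBrDl.
have h4 : c2 + e <= t by rewrite -lerBrDl.
move=> /(_ h1 h2 h3 h4) /le_trans; apply.
by rewrite -/K mulrC -ler_pdivlMr.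
Qed.

(** The real part of [1 / w] is [Re w / |w| ^ 2], and a small [u] cannot cancel
    it: this bounds the difference quotient below on each side of a rectangle,
    up to a rotation. *)
Lemma Re_quotient_ge (u w : R[i]) (d D : R) : 0 < d -> d <= complex.Re w ->
  normc w <= D -> normc u * D <= d / 2 ->
  d / (2 * D ^+ 2) <= complex.Re ((1 - u) / w).
Proof.
case: u w => u1 u2 [p q] d0 /= dp wD uD.
have p0 : 0 < p by exact: lt_le_trans dp.
have w0 : 0 < p ^+ 2 + q ^+ 2 by rewrite ltr_pwDl ?exprn_gt0 ?sqr_ge0.
have D0 : 0 < D.
  by apply: lt_le_trans wD; rewrite sqrtr_gt0.
have wD2 : p ^+ 2 + q ^+ 2 <= D ^+ 2.
  rewrite -(sqr_sqrtr (ltW w0)); rewrite ler_pXn2r ?nnegrE ?sqrtr_ge0//;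
    exact: ltW.
have uw : u1 * p + u2 * q <= d / 2.
  apply: le_trans uD; apply: (@le_trans _ _ (Num.sqrt (u1 ^+ 2 + u2 ^+ 2) *
    Num.sqrt (p ^+ 2 + q ^+ 2))).
    rewrite -sqrtrM ?addr_ge0 ?sqr_ge0//; apply: (le_trans (ler_norm _)).
    rewrite -sqrtr_sqr ler_wsqrtr// -subr_ge0.
    have -> : (u1 ^+ 2 + u2 ^+ 2) * (p ^+ 2 + q ^+ 2) - (u1 * p + u2 * q) ^+ 2
      = (u1 * q - u2 * p) ^+ 2 by ring.
    exact: sqr_ge0.
  by rewrite ler_wpM2l ?sqrtr_ge0.
have -> : (1 - u1) * (p / (p ^+ 2 + q ^+ 2)) - (0 - u2) * - (q / (p ^+ 2 + q ^+
  2))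
  = (p - (u1 * p + u2 * q)) / (p ^+ 2 + q ^+ 2) by field; rewrite gt_eqF.
have -> : d / (2 * D ^+ 2) = d / 2 / D ^+ 2 by rewrite invfM mulrA.
apply: ler_pM.
- by rewrite divr_ge0 // ltW.
- by rewrite invr_ge0 exprn_ge0 // ltW.
- by clear -dp uw; lra.
- by rewrite lef_pV2 ?posrE ?exprn_gt0.
Qed.

Lemma normcX (z : R[i]) n : normc (z ^+ n) = normc z ^+ n.
Proof.
elim: n => [|n IH]; first by rewrite !expr0 Normc.normc1.
by rewrite !exprS Normc.normcM IH.
Qed.

Lemma Re_div_opp (z : R[i]) (p q : R) :
  complex.Re (z / (p +i* q)) = - complex.Re (z / (- p +i* - q)).
Proof. by case: z => u v /=; rewrite !sqrrN; ring. Qed.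

Lemma Im_div_rot (z : R[i]) (p q : R) :
  complex.Im (z / (p +i* q)) = complex.Re (z / (- q +i* p)).
Proof. by case: z => u v /=; rewrite !sqrrN [q ^+ 2 + _]addrC; ring. Qed.

Lemma Rintegral_itv_ge a b (h : R -> R) (k : R) : a <= b ->
  mu.-integrable `[a, b] (EFin \o h) -> (forall x, a <= x <= b -> k <= h x) ->
  k * (b - a) <= \int[mu]_(x in `[a, b]) h x.
Proof.
move=> ab hi kh.
have -> : k * (b - a) = \int[mu]_(x in `[a, b]) k.
  rewrite Rintegral_cst//= lebesgue_measure_itv/= lte_fin.
  by move: ab; rewrite le_eqVlt => /predU1P[->|->]//=;
    rewrite ltxx subrr !mulr0.
apply: le_Rintegral => //; apply: continuous_compact_integrable.
  exact: segment_compact.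
by apply: continuous_subspaceT => x; exact: cvg_cst.
Qed.

Lemma Rintegral_itv_le a b (h : R -> R) (k : R) : a <= b ->
  mu.-integrable `[a, b] (EFin \o h) -> (forall x, a <= x <= b -> h x <= k) ->
  \int[mu]_(x in `[a, b]) h x <= k * (b - a).
Proof.
move=> ab hi kh.
have -> : k * (b - a) = \int[mu]_(x in `[a, b]) k.
  rewrite Rintegral_cst//= lebesgue_measure_itv/= lte_fin.
  by move: ab; rewrite le_eqVlt => /predU1P[->|->]//=;
    rewrite ltxx subrr !mulr0.
apply: le_Rintegral => //; apply: continuous_compact_integrable.
  exact: segment_compact.
by apply: continuous_subspaceT => x; exact: cvg_cst.
Qed.

Lemma sides_contra (h1 h2 v1 v2 k l : R) :
  h1 <= - k -> k <= h2 -> l <= v1 -> v2 <= - l -> h1 - h2 + (v2 - v1) = 0 ->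
  0 < l -> 0 < k -> False.
Proof. by move=> *; lra. Qed.

(** If [f = 1] at the centre [c] and [f] is small on the boundary,
  the difference
    quotient is close to [- 1 / (z - c)] there. Its integral then has a
    negative imaginary part, each side contributing with the same sign, whereas
    the integral is zero. *)
Lemma no_small_boundary_values a b s t (c1 c2 d : R) f :
  0 < d -> a + d <= c1 <= b - d -> s + d <= c2 <= t - d ->
  (forall z, in_rect a b s t z -> derivable f z 1) ->
  f (c1 +i* c2) = 1 ->
  (forall x, a <= x <= b -> normc (f (x +i* s)) * (b - a + (t - s)) <= d / 2 /\
     normc (f (x +i* t)) * (b - a + (t - s)) <= d / 2) ->
  (forall y, s <= y <= t -> normc (f (a +i* y)) * (b - a + (t - s)) <= d / 2 /\
     normc (f (b +i* y)) * (b - a + (t - s)) <= d / 2) ->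
  False.
Proof.
move=> d0 /andP[ac cb] /andP[sc ct] df fc hM vM.
have hc1 : a < c1 < b by apply/andP; split; clear -d0 ac cb; lra.
have hc2 : s < c2 < t by apply/andP; split; clear -d0 sc ct; lra.
have [l [cq q0]] := contour_diffquot hc1 hc2 df.
set c : C := c1 +i* c2 in cq q0; set q := diffquot c l f in cq q0.
set D := b - a + (t - s) in hM vM.
set k := d / (2 * D ^+ 2).
have ab : a < b by clear -hc1; case/andP: hc1; exact: lt_trans.
have st : s < t by clear -hc2; case/andP: hc2; exact: lt_trans.
have D0 : 0 < D by rewrite addr_gt0 ?subr_gt0.
have k0 : 0 < k by rewrite divr_gt0 // mulr_gt0 // exprn_gt0.
have wD (x y : R) : a <= x <= b -> s <= y <= t ->
  normc ((x - c1) +i* (y - c2)) <= D.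
  move=> /andP[x1 x2] /andP[y1 y2]; apply: (le_trans (normc_le_ReIm _)).
  apply: lerD; rewrite /= ler_norml; apply/andP; split.
  - by clear -d0 cb x1; lra.
  - by clear -d0 ac x2; lra.
  - by clear -d0 ct y1; lra.
  - by clear -d0 sc y2; lra.
have qE (x y : R) : x != c1 \/ y != c2 ->
    q (x +i* y) = - ((1 - f (x +i* y)) / ((x - c1) +i* (y - c2))).
  move=> xy; rewrite /q /diffquot fc ifF; last first.
    by apply/negbTE/eqP => -[xc yc]; case: xy => /eqP.
  by rewrite -mulNr opprB mulrC; congr (_ * _^-1).
have normN (x y : R) : normc (- x +i* - y) = normc (x +i* y) by rewrite /=
  !sqrrN.
have normR (x y : R) : normc (- y +i* x) = normc (x +i* y).
  by rewrite /= sqrrN addrC.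
have Hs x : a <= x <= b -> complex.Im (q (x +i* s)) <= - k.
  move=> hx; rewrite qE; last by right; rewrite lt_eqF // (lt_le_trans _ sc)//
    ltrDl.
  rewrite raddfN /= lerN2 Im_div_rot; apply: Re_quotient_ge => //=.
  - by clear -sc; lra.
  - by have := wD x s hx; rewrite -normR; apply; rewrite lexx ltW.
  - exact: (hM x hx).1.
have Ht x : a <= x <= b -> k <= complex.Im (q (x +i* t)).
  move=> hx; rewrite qE; last by right; rewrite gt_eqF // (le_lt_trans ct)//
    ltrBlDr ltrDl.
  rewrite raddfN /= Im_div_rot Re_div_opp opprK; apply: Re_quotient_ge => //=.
  - by clear -ct; lra.
  - by have := wD x t hx; rewrite -normR -normN; apply; rewrite lexx ltW.
  - exact: (hM x hx).2.
have Va y : s <= y <= t -> k <= complex.Re (q (a +i* y)).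
  move=> hy; rewrite qE; last by left; rewrite lt_eqF // (lt_le_trans _ ac)//
    ltrDl.
  rewrite raddfN /= Re_div_opp opprK; apply: Re_quotient_ge => //=.
  - by clear -ac; lra.
  - by have := wD a y; rewrite -normN; apply; rewrite // lexx ltW.
  - exact: (vM y hy).1.
have Vb y : s <= y <= t -> complex.Re (q (b +i* y)) <= - k.
  move=> hy; rewrite qE; last by left; rewrite gt_eqF // (le_lt_trans cb)//
    ltrBlDr ltrDl.
  rewrite raddfN /= lerN2; apply: Re_quotient_ge => //=.
  - by clear -cb; lra.
  - by apply: wD; rewrite // lexx ltW.
  - exact: (vM y hy).2.
have [_ hi_s] := cintegrable_horizontal cq (y :=
  s) (introT andP (conj (lexx _) (ltW st))).
have [_ hi_t] := cintegrable_horizontal cq (y :=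
  t) (introT andP (conj (ltW st) (lexx _))).
have [vi_a _] := cintegrable_vertical cq (x :=
  a) (introT andP (conj (lexx _) (ltW ab))).
have [vi_b _] := cintegrable_vertical cq (x :=
  b) (introT andP (conj (ltW ab) (lexx _))).
have I1 := Rintegral_itv_le (ltW ab) hi_s Hs.
have I2 := Rintegral_itv_ge (ltW ab) hi_t Ht.
have I3 := Rintegral_itv_ge (ltW st) vi_a Va.
have I4 := Rintegral_itv_le (ltW st) vi_b Vb.
have := congr1 (fun z : R[i] => complex.Im z) q0.
rewrite /contour /cint /=.
rewrite mul0r mul1r add0r => E.
have : 0 < k * (b - a) by rewrite mulr_gt0 ?subr_gt0.
have : 0 < k * (t - s) by rewrite mulr_gt0 ?subr_gt0.
rewrite !mulNr in I1 I4.
exact: (sides_contra I1 I2 I3 I4 E).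
Qed.

(** If [|f c| > B], a high power of [f / f c] is as small as desired on the
    boundary while keeping the value 1 at [c]; taking powers removes the
    constants lost in the estimates of contour integrals. *)
Theorem rectangle_maximum_principle a b s t (c1 c2 B : R) f :
  a < c1 < b -> s < c2 < t ->
  (forall z, in_rect a b s t z -> derivable f z 1) ->
  (forall x, a <= x <= b ->
     normc (f (x +i* s)) <= B /\ normc (f (x +i* t)) <= B) ->
  (forall y, s <= y <= t ->
     normc (f (a +i* y)) <= B /\ normc (f (b +i* y)) <= B) ->
  normc (f (c1 +i* c2)) <= B.
Proof.
move=> /andP[ac cb] /andP[sc ct] df hM vM.
rewrite leNgt; apply/negP => Bc; set v := f _ in Bc.
have ab : a < b by exact: lt_trans ac cb.
have st : s < t by exact: lt_trans sc ct.
have B0 : 0 <= B.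
  by apply: le_trans (hM a _).1; rewrite ?normc_ge0 ?lexx ?ltW.
have v0 : 0 < normc v by exact: le_lt_trans Bc.
have vn : v != 0 by apply/eqP => vE; rewrite vE Normc.normc0 ltxx in v0.
pose d := Num.min (Num.min (c1 - a) (b - c1)) (Num.min (c2 - s) (t - c2)).
have d0 : 0 < d by rewrite !lt_min !subr_gt0 ac cb sc ct.
have : d <= d by [].
rewrite {2}/d !le_min => /andP[/andP[i3 i4] /andP[i5 i6]].
pose D := b - a + (t - s).
have D0 : 0 < D by rewrite addr_gt0 ?subr_gt0.
pose r := B / normc v.
have r0 : 0 <= r by rewrite divr_ge0 ?normc_ge0.
have r1 : r < 1 by rewrite ltr_pdivrMr // mul1r.
have [m hm] : exists m : nat, r ^+ m * D <= d / 2.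
  have dD : 0 < d / 2 / D by rewrite !divr_gt0.
  have : r ^+ n @[n --> \oo] --> (0 : R) by apply: cvg_expr; rewrite ger0_norm.
  move=> /cvgr0Pnorm_lt /(_ _ dD) [m _ /(_ m (leqnn m))] /=.
  rewrite ger0_norm ?exprn_ge0 // => h; exists m.
  by rewrite -ler_pdivlMr // ltW.
pose g (z : C) : C := (v^-1 * f z) ^+ m.
have bd z : normc (f z) <= B -> normc (g z) * D <= d / 2.
  move=> fB; apply: le_trans hm; apply: ler_wpM2r; first exact: ltW.
  rewrite /g normcX; apply: lerXn2r; rewrite ?nnegrE ?normc_ge0 //.
  rewrite Normc.normcM Normc.normcV mulrC.
  by apply: ler_wpM2r; rewrite ?invr_ge0 ?normc_ge0.
have dg z : in_rect a b s t z -> derivable g z 1.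
  move=> hz; apply: derivable_funX; apply: derivable_funM;
    last exact: (df z hz).
  exact: derivable_cst.
have c1d : a + d <= c1 <= b - d by apply/andP; split; clear -i3 i4; lra.
have c2d : s + d <= c2 <= t - d by apply/andP; split; clear -i5 i6; lra.
have gc : g (c1 +i* c2) = 1 by rewrite /g mulVf // expr1n.
apply: (no_small_boundary_values d0 c1d c2d dg gc).
- by move=> x /hM[? ?]; split; exact: bd.
- by move=> x /vM[? ?]; split; exact: bd.
Qed.
End MaximumPrinciple.

(** * The three lines theorem *)

Section ThreeLines.
Variable R : realType.
Notation C := (Cplx R).
Implicit Types (f G : C -> C) (x y A M : R).

Definition continuous_on_strip f : Prop :=
  forall z : C, strip z -> forall e : R, 0 < e -> exists2 d : R, 0 < d &
    forall w : C, strip w -> normc (w - z) < d -> normc (f w - f z) < e.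

(** Differentiability is known only inside the strip, so rectangles must stay
    away from the boundary lines; compactness of a segment of the line gives
    the bound at a uniform distance from it. *)
Lemma near_boundary_line f (x0 A T e : R) : continuous_on_strip f ->
  0 <= x0 <= 1 ->
  0 < e -> (forall y, normc (f (x0 +i* y)) <= A) ->
  exists2 d : R, 0 < d & forall x y, 0 <= x <= 1 -> `|x - x0| < d ->
    - T <= y <= T -> normc (f (x +i* y)) <= A + e.
Proof.
move=> cf x01 e0 fA.
have := (compact_near_coveringP _).1 (@segment_compact R (- T) T) _ (nbhs x0)
  (fun x y => 0 <= x <= 1 -> normc (f (x +i* y)) <= A + e) _.
have loc y : [set` `[- T, T]] y -> \forall y' \near y & x \near x0,
    0 <= x <= 1 -> normc (f (x +i* y')) <= A + e.
  move=> _; have [d d0 hd] := cf (x0 +i* y) x01 e e0.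
  have d2 : 0 < d / 2 by rewrite divr_gt0.
  exists (ball y (d / 2), ball x0 (d / 2)).
    by split; exact: nbhsx_ballx.
  move=> [y' x] /= [by' bx] x01'.
  have -> : f (x +i* y') = f (x0 +i* y) + (f (x +i* y') - f (x0 +i* y))
    by rewrite subrKC.
  apply: (le_trans (le_normcD _ _)); apply: lerD => //; apply/ltW/hd => //.
  apply: (le_lt_trans (normc_le_ReIm _)).
  have -> : d = d / 2 + d / 2 by field.
  by apply: ltrD; rewrite /= distrC.
move=> /(_ _ loc) /nbhs_ballP[d d0 hd]; exists d => // x y x01' xd yT.
by apply: (hd x) => //; rewrite /ball/= distrC.
Qed.

(** Division by [1 + e z], of modulus at least 1 on the strip, makes the bounded
    function [G] small at height [T], and the maximum principle applies to a
    tall rectangle. *)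
Theorem three_lines G (A M : R) (theta : R) : 0 < theta < 1 ->
  continuous_on_strip G -> (forall z : C, open_strip z -> derivable G z 1) ->
  (forall z : C, strip z -> normc (G z) <= M) ->
  (forall y, normc (G (0 +i* y)) <= A) -> (forall y,
    normc (G (1 +i* y)) <= A) ->
  normc (G theta%:C) <= A.
Proof.
move=> /andP[t0 t1] cG dG GM G0 G1.
have A0 : 0 <= A by apply: le_trans (G0 0); exact: normc_ge0.
have M0 : 0 <= M.
  by apply: le_trans (GM (0 : C) _); [exact: normc_ge0|rewrite /strip /= lexx
    ler01].
apply/ler_addgt0Pr => k k0.
(* Chosen so that (A + e) * (1 + e) <= A + k in the end. *)
pose e := Num.min 1 (k / (A + 2)).
have A2 : 0 < A + 2 by rewrite ltr_wpDl.
have e0 : 0 < e by rewrite lt_min ltr01 divr_gt0.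
have e1 : e <= 1 by rewrite ge_min lexx.
have ek : e * (A + 2) <= k by rewrite -ler_pdivlMr // ge_min lexx orbT.
pose H (z : C) : C := G z * (1 + (e%:C : C) * z)^-1.
have Ae : 0 < A + e by rewrite ltr_wpDl.
(* At height T the denominator is at least e * T, hence |H| <= A + e. *)
pose T := M / (e * (A + e)) + 1.
have T0 : 0 < T by rewrite ltr_wpDl // divr_ge0 // mulr_ge0 // ltW.
have [d0 d00 hd0] := near_boundary_line T cG (x0 :=
  0) (introT andP (conj (lexx _) ler01)) e0 G0.
have [d1 d10 hd1] := near_boundary_line T cG (x0 :=
  1) (introT andP (conj ler01 (lexx _))) e0 G1.
pose s := Num.min (Num.min (d0 / 2) (d1 / 2)) (Num.min (theta / 2) ((1 - theta)
  / 2)).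
have s0 : 0 < s by rewrite !lt_min !divr_gt0 // subr_gt0.
have : s <= s by [].
rewrite {2}/s !le_min => /andP[/andP[i3 i4] /andP[i5 i6]].
have den_re (x y : R) : complex.Re (1 + (e%:C : C) * (x +i* y)) = 1 + e * x.
  by rewrite /= mul0r subr0.
have den_im (x y : R) : complex.Im (1 + (e%:C : C) * (x +i* y)) = e * y.
  by rewrite /= mul0r addr0 add0r.
have den1 (x y : R) : 0 <= x -> 1 <= normc (1 + (e%:C : C) * (x +i* y)).
  move=> x0; apply: le_trans (Re_le_normc _); rewrite den_re.
  by rewrite ger0_norm ?addr_ge0 ?mulr_ge0 ?(ltW e0)// lerDl mulr_ge0 // ltW.
have denT (x y : R) : e * `|y| <= normc (1 + (e%:C : C) * (x +i* y)).
  by apply: le_trans (Im_le_normc _); rewrite den_im normrM (gtr0_norm e0).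
have den_neq0 (x y : R) : 0 <= x -> 1 + (e%:C : C) * (x +i* y) != 0.
  move=> x0; apply/eqP => E; have := den1 x y x0.
  by rewrite E Normc.normc0 ler10.
have HG (x y : R) : 0 <= x -> normc (H (x +i* y)) <= normc (G (x +i* y)).
  move=> x0; rewrite /H Normc.normcM Normc.normcV.
  by apply: ler_piMr; rewrite ?normc_ge0 // invf_le1 ?den1 // (lt_le_trans
    ltr01) ?den1.
have HT (x y : R) : 0 <= x <= 1 -> `|y| = T -> normc (H (x +i* y)) <= A + e.
  move=> x01 yT; rewrite /H Normc.normcM Normc.normcV.
  have dp : 0 < normc (1 + (e%:C : C) * (x +i* y)).
    by rewrite (lt_le_trans ltr01) // den1 //; case/andP: x01.
  rewrite ler_pdivrMr //; apply: (le_trans (GM (x +i* y) x01)).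
  apply: (@le_trans _ _ ((A + e) * (e * `|y|))); last first.
    by rewrite ler_wpM2l // ltW.
  rewrite yT /T mulrDr mulr1 mulrDr.
  rewrite (_ : (A + e) * (e * (M / (e * (A + e)))) = M); last first.
    by field; rewrite !gt_eqF.
  by rewrite lerDl mulr_ge0 // ltW.
have dH (z : C) : in_rect s (1 - s) (- T) T z -> derivable H z 1.
  move=> [/andP[z1 z2] _].
  apply: derivable_funM.
    apply: dG; apply/andP; split; first exact: lt_le_trans z1.
    by apply: (le_lt_trans z2); rewrite ltrBlDr ltrDl.
  apply: derivable_funV.
    by case: (z) z1 => x y /= z1; apply: den_neq0; exact: le_trans (ltW s0) z1.
  apply: derivable_funD; first exact: derivable_cst.
  by apply: derivable_funM; [exact: derivable_cst|exact: derivable_id].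
have hc1 : s < theta < 1 - s by clear -i5 i6 t0 t1; apply/andP; split; lra.
have hc2 : - T < 0 < T by rewrite oppr_lt0 T0.
have s1 : s <= 1 by clear -i5 t1 t0; lra.
have := rectangle_maximum_principle (B := A + e) hc1 hc2 dH.
have -> : (theta +i* 0 : C) = theta%:C by [].
move=> mp.
have {mp} Ht : normc (H theta%:C) <= A + e.
  apply: mp.
    move=> x /andP[x1 x2].
    have x01 : 0 <= x <= 1 by clear -x1 x2 s0; apply/andP; split; lra.
    by split; apply: HT => //; rewrite ?normrN gtr0_norm.
  move=> y yT; split.
    apply: (le_trans (HG _ _ (ltW s0))); apply: hd0 => //.
      by rewrite (ltW s0) s1.
    by rewrite subr0 gtr0_norm //; clear -i3 d00; lra.
  have s10 : 0 <= 1 - s by rewrite subr_ge0.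
  apply: (le_trans (HG _ _ s10)); apply: hd1 => //.
    by rewrite s10 lerBlDr lerDl ltW.
  by rewrite addrAC subrr sub0r normrN gtr0_norm //; clear -i4 d10; lra.
have -> : G theta%:C = H theta%:C * (1 + (e%:C : C) * theta%:C).
  by rewrite /H mulfVK // (den_neq0 theta 0) // ltW.
rewrite Normc.normcM.
have dn : normc (1 + (e%:C : C) * theta%:C) <= 1 + e.
  apply: (le_trans (le_normcD _ _)); rewrite Normc.normc1 lerD2l Normc.normcM
    !normc_real.
  by rewrite !gtr0_norm // ler_piMr // ltW.
apply: (@le_trans _ _ ((A + e) * (1 + e))).
  by apply: ler_pM; rewrite ?normc_ge0.
apply: (@le_trans _ _ (A + e * (A + 2))); last by rewrite lerD2l.
rewrite -subr_ge0 (_ : _ - _ = e * (1 - e)); last by ring.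
by rewrite mulr_ge0 ?subr_ge0 // ltW.
Qed.

End ThreeLines.

(** * The complex exponential *)

Section ComplexExponential.
Variable R : realType.
Notation C := (Cplx R).
Implicit Types (z h k : C).

Definition cexp (z : R[i]) : C :=
  (expR (complex.Re z) * cos (complex.Im z))
    +i* (expR (complex.Re z) * sin (complex.Im z)).

Lemma cexpD z h : cexp (z + h) = cexp z * cexp h.
Proof.
case: (z) (h) => a b [u v]; apply: complex_ext; rewrite /= expRD ?cosD ?sinD;
  ring.
Qed.

Lemma cexp0 : cexp 0 = 1.
Proof.
by apply: complex_ext; rewrite /= expR0 ?cos0 ?sin0 mul1r.
Qed.

Lemma normc_cexp (z : R[i]) : normc (cexp z) = expR (complex.Re z).
Proof.
by rewrite /cexp /= !exprMn -mulrDr cos2Dsin2 mulr1 sqrtr_sqr ger0_norm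
  ?expR_ge0.
Qed.

Lemma is_derive_linear_approx (f : R -> R) (l e : R) :
  is_derive (0 : R) 1 f l ->
  0 < e -> \forall t \near (0 : R), `|f t - f 0 - l * t| <= e * `|t|.
Proof.
move=> [df fl] e0.
have /cvgrPdist_le /(_ e e0) : h^-1 *: ((f \o shift 0) (h *: 1) - f 0) @[h -->
  0^'] --> l.
  by rewrite -fl.
rewrite near_withinE; apply: filterS => t ht.
have [->|t0] := eqVneq t 0; first by rewrite mulr0 normr0 mulr0 subrr subr0
  normr0.
have := ht t0; rewrite /= addr0 /GRing.scale /= mulr1 => H.
have -> : f t - f 0 - l * t = - (l - t^-1 * (f t - f 0)) * t by field.
by rewrite normrM normrN ler_wpM2r.
Qed.

Lemma cexp_linear_approx (e : R) : 0 < e -> exists2 d : R, 0 < d &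
  forall h, normc h < d -> normc (cexp h - 1 - h) <= e * normc h.
Proof.
(* The parts of cexp h - 1 - h are errors of the real functions times factors
   at most 2; in all, six times n times the modulus of h. *)
move=> e0; set n := e / 6.
have n0 : 0 < n by rewrite divr_gt0.
have he := is_derive_linear_approx (is_derive_expR 0) n0.
have hc := is_derive_linear_approx (is_derive_cos 0) n0.
have hs := is_derive_linear_approx (is_derive_sin 0) n0.
have ce : \forall t \near (0 : R), `|expR t - 1| <= n /\ expR t <= 2.
  have /cvgrPdist_le c : expR t @[t --> (0 : R)] -->
    expR 0 by exact: continuous_expR.
  near=> t; split.
    by rewrite -expR0 distrC; near: t; exact: c.
  have : `|expR 0 - expR t| <= 1 by near: t; exact: c.
  by rewrite expR0 ler_norml => /andP[+ _]; clear; lra.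
have /nbhs_ballP[d d0 hd] : \forall t \near (0 : R),
   [/\ `|expR t - expR 0 - expR 0 * t| <= n * `|t|,
     `|cos t - cos 0 - - sin 0 * t| <= n * `|t|,
     `|sin t - sin 0 - cos 0 * t| <= n * `|t|,
     `|expR t - 1| <= n & expR t <= 2].
  near=> t; split; first by near: t.
  - by near: t.
  - by near: t.
  - by have [] : `|expR t - 1| <= n /\ expR t <= 2 by near: t.
  - by have [] : `|expR t - 1| <= n /\ expR t <= 2 by near: t.
exists d => // -[a b] hab.
have ha : `|a| <= normc (a +i* b) by exact: (Re_le_normc (a +i* b)).
have hb : `|b| <= normc (a +i* b) by exact: (Im_le_normc (a +i* b)).
have [] := hd a; first by rewrite /ball/= sub0r normrN (le_lt_trans ha).
rewrite expR0 mul1r => E1 _ _ E2 E3.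
have [] := hd b; first by rewrite /ball/= sub0r normrN (le_lt_trans hb).
rewrite cos0 sin0 oppr0 mul0r !subr0 addr0 mul1r => _ C1 S1 _ _.
set N := normc (a +i* b) in ha hb hab *.
apply: (le_trans (normc_le_ReIm _)) => /=.
rewrite subr0.
have -> : expR a * cos b - 1 - a = (expR a - 1 - a) + expR a * (cos b - 1)
  by ring.
have -> : expR a * sin b - b = expR a * (sin b - b) + (expR a - 1) * b by ring.
have p0 := expR_ge0 a.
have nN (x : R) : `|x| <= N -> n * `|x| <= n * N by move=> ?;
  rewrite ler_wpM2l // ltW.
have P1 : `|expR a * (cos b - 1)| <= 2 * (n * N).
  rewrite normrM (ger0_norm p0); apply: ler_pM => //;
    exact: (le_trans C1 (nN _ hb)).
have P2 : `|expR a * (sin b - b)| <= 2 * (n * N).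
  rewrite normrM (ger0_norm p0); apply: ler_pM => //;
    exact: (le_trans S1 (nN _ hb)).
have P3 : `|(expR a - 1) * b| <= n * N by rewrite normrM ler_pM.
have P4 : `|expR a - 1 - a| <= n * N by exact: (le_trans E1 (nN _ ha)).
have -> : e * N = (n * N + 2 * (n * N)) + (2 * (n * N) + n * N) by rewrite /n;
  field.
by apply: lerD; apply: (le_trans (ler_normD _ _)); apply: lerD.
Unshelve. all: by end_near. Qed.

Lemma derivable_cexp_scale (c z : C) :
  derivable (fun w : C => cexp (c * w)) z 1.
Proof.
apply/derivable_normcP; exists (cexp (c * z) * c) => e e0.
set K := normc (cexp (c * z)) * normc c + 1.
have K0 : 0 < K by rewrite ltr_wpDl // mulr_ge0 ?normc_ge0.
have eK : 0 < e / K by rewrite divr_gt0.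
have [d d0 hd] := cexp_linear_approx eK.
have c1 : 0 < normc c + 1 by rewrite ltr_wpDl ?normc_ge0.
exists (d / (normc c + 1)); first by rewrite divr_gt0.
move=> h h0 hh.
have nh : 0 < normc h.
  rewrite lt_neqAle normc_ge0 andbT eq_sym; apply: contra h0 =>
    /eqP/Normc.eq0_normc/eqP.
  by [].
have -> : h^-1 * (cexp (c * (z + h)) - cexp (c * z)) - cexp (c * z) * c
    = cexp (c * z) * (h^-1 * (cexp (c * h) - 1 - c * h)).
  by rewrite [c * (z + h)]mulrDr cexpD; field.
rewrite !Normc.normcM Normc.normcV.
have chd : normc (c * h) < d.
  rewrite Normc.normcM; apply: (@le_lt_trans _ _ ((normc c + 1) * normc h)).
    by rewrite ler_wpM2r ?normc_ge0 // lerDl.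
  by rewrite mulrC -ltr_pdivlMr.
have := hd _ chd; rewrite Normc.normcM => H.
apply: (@le_lt_trans _ _ (normc (cexp (c * z)) * ((normc h)^-1 * (e / K *
  (normc c * normc h))))).
  by rewrite ler_wpM2l ?normc_ge0 // ler_wpM2l // invr_ge0 normc_ge0.
have -> : normc (cexp (c * z)) * ((normc h)^-1 * (e / K * (normc c * normc h)))
    = e * ((K - 1) / K) by rewrite {2}/K; field; rewrite !gt_eqF.
rewrite -[ltRHS]mulr1 ltr_pM2l // ltr_pdivrMr // mul1r.
by rewrite ltrBlDr ltrDl.
Qed.

End ComplexExponential.

(** * Interpolation norms of a vector controlled by a functional *)

Section InterpolationBounds.
Variables (R : realType) (V : lmodType R[i]) (N0 N1 : V -> \bar R).
Variables (L : V -> R[i]) (x : V) (s : R).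
Notation C := (Cplx R).

(** The line through [x] and the functional [L] are dual to each other at both
    ends: [N0 x = 1 = 1 / |L|_0] and [N1 x = s = 1 / |L|_1]. *)
Hypothesis s1 : 1 <= s.
Hypothesis N0x : forall c : R[i], (N0 (c *: x)%R <= (normc c)%:E)%E.
Hypothesis N1x : forall c : R[i], (N1 (c *: x)%R <= (s * normc c)%:E)%E.
Hypothesis LB : forall u v, L (u - v) = L u - L v.
Hypothesis LZ : forall c u, L (c *: u) = c * L u.
Hypothesis LN0 : forall u, ((normc (L u))%:E <= N0 u)%E.
Hypothesis LN1 : forall u, ((s * normc (L u))%:E <= N1 u)%E.
Hypothesis Lx : L x = 1.

Let s0 : 0 < s. Proof. exact: lt_le_trans s1. Qed.

Lemma functional_le_sum_norm u : ((normc (L u))%:E <= sum_norm N0 N1 u)%E.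
Proof.
apply: le_ereal_inf_tmp => _ [y _ <-].
have -> : L u = L y + L (u - y) by rewrite LB subrKC.
apply: (@le_trans _ _ ((normc (L y))%:E + (normc (L (u - y)))%:E)%E).
  by rewrite -EFinD lee_fin; exact: le_normcD.
apply: leeD; first exact: LN0.
apply: le_trans (LN1 _); rewrite lee_fin.
by apply: ler_peMl => //; exact: normc_ge0.
Qed.

Lemma sum_norm_line_le (c : R[i]) :
  (sum_norm N0 N1 (c *: x)%R <= (normc c)%:E)%E.
Proof.
apply: (@le_trans _ _ (N0 (c *: x)%R + N1 (c *: x - c *: x)%R)%E).
  by apply: ereal_inf_lbound; exists (c *: x).
rewrite subrr; have N10 : (N1 0%R <= 0)%E.
  by have := N1x 0; rewrite scale0r Normc.normc0 mulr0.
by rewrite -[leRHS]adde0; apply: leeD.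
Qed.

Let l := ln s.
(** [s ^ (theta - z)], of modulus [s ^ theta] on the left line and
    [s ^ (theta - 1)] on the right one. *)
Let g (theta : R) (z : R[i]) : C := cexp (((l * theta)%:C : C) + (- (l%:C :
  C)) * z).

Let normc_g theta z : normc (g theta z) = expR (l * (theta - complex.Re z)).
Proof.
rewrite /g normc_cexp; case: z => a b /=; congr expR.
by rewrite oppr0 mul0r subr0; ring.
Qed.

Let derivable_g theta (z : C) : derivable (g theta : C -> C) z 1.
Proof.
have h := derivable_funM (derivable_cst (cexp ((l * theta)%:C : C)) z 1)
  (@derivable_cexp_scale R (- (l%:C : C)) z).
have -> // : (g theta : C -> C)
  = (fun w => cst (cexp ((l * theta)%:C : C)) w * cexp (- (l%:C : C) * w)).
by apply/funext => w; rewrite /g cexpD.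
Qed.

Let l0 : 0 <= l. Proof. exact: ln_ge0. Qed.

Let s_powE t : s `^ t = expR (l * t).
Proof. by rewrite /powR gt_eqF // mulrC. Qed.

Let continuous_line (N : V -> \bar R) (k theta : R) (A : set R[i]) :
  0 < k -> (forall c : R[i], (N (c *: x)%R <= (k * normc c)%:E)%E) ->
  continuous_on N A (fun z => g theta z *: x).
Proof.
move=> k0 Nk z _ e e0.
have /continuous_normcP cg := derivable_continuous (@derivable_g theta z).
have [d d0 hd] := cg (e / k) (divr_gt0 e0 k0).
exists d => // w _ /hd hw; rewrite -scalerBl; apply: (le_lt_trans (Nk _)).
by rewrite lte_fin mulrC -ltr_pdivlMr.
Qed.

Lemma exponential_calderon_fun theta : 0 < theta < 1 ->
  calderon_fun N0 N1 (fun z => g theta z *: x) /\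
  (calderon_norm N0 N1 (fun z => g theta z *: x) <= (s `^ theta)%:E)%E.
Proof.
move=> /andP[t0 t1].
have b0 z : re_line 0 z -> (N0 (g theta z *: x)%R <= (s `^ theta)%:E)%E.
  move=> z0; apply: (le_trans (N0x _)); rewrite normc_g z0 subr0 s_powE.
  by rewrite lexx.
have b1 z : re_line 1 z -> (N1 (g theta z *: x)%R <= (s `^ theta)%:E)%E.
  move=> z1; apply: (le_trans (N1x _)); rewrite normc_g z1 s_powE lee_fin.
  rewrite -{1}(lnK (s0 : s \is Num.pos)) -expRD -/l ler_expR.
  by rewrite mulrBr mulr1 subrKC.
have N0x' (c : R[i]) : (N0 (c *: x)%R <= (1 * normc c)%:E)%E by rewrite mul1r.
have Nsx' (c : R[i]) : (sum_norm N0 N1 (c *: x)%R <= (1 * normc c)%:E)%E.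
  by rewrite mul1r; exact: sum_norm_line_le.
split; last first.
  rewrite /calderon_norm ge_max; apply/andP; split.
    by apply: ge_ereal_sup => _ [z /b0 h <-].
  by apply: ge_ereal_sup => _ [z /b1 h <-].
split.
- split; last exact: continuous_line Nsx'.
  exists (expR (l * theta)) => z /andP[z0 z1];
    apply: (le_trans (sum_norm_line_le _)).
  by rewrite normc_g lee_fin ler_expR ler_wpM2l // gerBl.
- move=> z _; have /derivable_normcP[g' hg'] := @derivable_g theta z.
  exists (g' *: x) => e /hg'[d d0 hd]; exists d => // h h0 /(hd h h0) H.
  rewrite -scalerBl scalerA -scalerBl; apply: (le_lt_trans (sum_norm_line_le
    _)).
  by rewrite lte_fin.
- split; last exact: continuous_line N0x'.
  by exists (s `^ theta) => z /b0.
- split; last exact: continuous_line N1x.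
  by exists (s `^ theta) => z /b1.
Qed.

(** The three lines theorem for the scalar function [L (f z) * s ^ z]. *)
Lemma calderon_norm_ge f theta : 0 < theta < 1 -> calderon_fun N0 N1 f ->
  f theta%:C = x -> ((s `^ theta)%:E <= calderon_norm N0 N1 f)%E.
Proof.
move=> t01 [[[M hM] cf] hf _ _] fx.
have b0 z : re_line 0 z -> ((normc (L (f z)))%:E <= calderon_norm N0 N1 f)%E.
  move=> z0; apply: (le_trans (LN0 _)); rewrite /calderon_norm le_max.
  by rewrite ereal_sup_ubound //; exists z.
have b1 z : re_line 1 z -> ((s * normc (L (f z)))%:E <= calderon_norm N0 N1
  f)%E.
  move=> z1; apply: (le_trans (LN1 _)); rewrite /calderon_norm le_max.
  by rewrite orbC ereal_sup_ubound //; exists z.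
move: b0 b1; case: (calderon_norm N0 N1 f) => [A| |] b0 b1.
- pose E (z : C) : C := cexp ((l%:C : C) * z).
  have nE (z : C) : normc (E z) = expR (l * complex.Re z).
    by rewrite /E normc_cexp; case: (z : R[i]) => a b /=; rewrite mul0r subr0.
  pose G (z : C) : C := (L (f z) : C) * E z.
  have GE (z : C) : normc (G z) = normc (L (f z)) * expR (l * complex.Re z).
    by rewrite /G Normc.normcM nE.
  have Lf (z : C) : strip z -> normc (L (f z)) <= M.
    by move=> /hM h; rewrite -lee_fin; apply: le_trans h;
      exact: functional_le_sum_norm.
  have Es (z : C) : strip z -> expR (l * complex.Re z) <= s.
    move=> /andP[_ z1]; rewrite -[leRHS](lnK (s0 : s \is Num.pos)) ler_expR.
    by rewrite ler_piMr.
  have cE (z : C) := derivable_continuous (@derivable_cexp_scale R (l%:C :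
    C) z).
  have : normc (G theta%:C) <= A.
    apply: (@three_lines R G A (M * s) theta t01).
    + move=> z sz e e0.
      have M1 : 0 < M + 1.
        by rewrite ltr_wpDl // (le_trans _ (Lf z sz)) // normc_ge0.
      have [d1 d10 hd1] := cf z sz (e / 2 / s) (divr_gt0 (divr_gt0 e0 (ltr0Sn _
        1)) s0).
      have [d2 d20 hd2] := (continuous_normcP _ _).1 (cE z) (e / 2 / (M + 1))
        (divr_gt0 (divr_gt0 e0 (ltr0Sn _ 1)) M1).
      exists (Num.min d1 d2); first by rewrite lt_min d10.
      move=> w sw; rewrite lt_min => /andP[/(hd1 w sw) w1 /hd2 w2].
      have -> : G w - G z = (L (f w) - L (f z) : C) * E w + (L (f z) :
        C) * (E w - E z).
        by rewrite /G; ring.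
      apply: (le_lt_trans (le_normcD _ _)); rewrite !Normc.normcM nE.
      have -> : e = e / 2 + e / 2 by field.
      apply: ltr_leD.
        apply: (@le_lt_trans _ _ (normc (L (f w) - L (f z)) * s)).
          by rewrite ler_wpM2l ?normc_ge0 ?Es.
        rewrite -ltr_pdivlMr // -lte_fin; apply: le_lt_trans w1.
        by rewrite -LB; exact: functional_le_sum_norm.
      apply: (@le_trans _ _ ((M + 1) * normc (E w - E z))).
        by rewrite ler_wpM2r ?normc_ge0 // (le_trans (Lf z sz)) // lerDl.
      by rewrite mulrC -ler_pdivlMr // ltW.
    + move=> z oz; apply: derivable_funM; last exact: derivable_cexp_scale.
      apply/derivable_normcP; have [f' hf'] := hf z oz.
      exists (L f') => e /hf'[d d0 hd]; exists d => // h h0 /(hd h h0) H.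
      rewrite -lte_fin; apply: le_lt_trans H.
      by rewrite -LB -LZ -LB; exact: functional_le_sum_norm.
    + move=> z sz; rewrite GE; apply: ler_pM;
      rewrite ?normc_ge0 ?expR_ge0 ?Es //.
      exact: Lf.
    + move=> y; rewrite GE /= mulr0 expR0 mulr1 -lee_fin; exact: b0.
    + move=> y; rewrite GE /= mulr1 (lnK (s0 : s \is Num.pos)) mulrC -lee_fin;
      exact: b1.
  by rewrite GE fx Lx Normc.normc1 mul1r /= lee_fin s_powE.
- exact: leey.
- by have := b0 0 erefl.
Qed.

Theorem interp_norm_line theta : 0 <= theta <= 1 ->
  interp_norm theta N0 N1 x = (s `^ theta)%:E.
Proof.
move=> /andP[t0 t1]; rewrite /interp_norm; have [->|tn0] := eqVneq theta 0.
  rewrite powRr0; apply/eqP; rewrite eq_le; apply/andP; split.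
    by have := N0x 1; rewrite scale1r Normc.normc1.
  by have := LN0 x; rewrite Lx Normc.normc1.
have [->|tn1] := eqVneq theta 1.
  rewrite powRr1 ?(ltW s0)//; apply/eqP; rewrite eq_le; apply/andP; split.
    by have := N1x 1; rewrite scale1r Normc.normc1 mulr1.
  by have := LN1 x; rewrite Lx Normc.normc1 mulr1.
have t01 : 0 < theta < 1 by rewrite !lt_neqAle eq_sym tn0 tn1 t0.
apply/eqP; rewrite eq_le; apply/andP; split; last first.
  by apply: le_ereal_inf_tmp => _ [f [cf fx] <-]; exact: calderon_norm_ge.
have [cg ng] := exponential_calderon_fun t01.
apply: le_trans ng; apply: ereal_inf_lbound.
exists (fun z => g theta z *: x) => //; split=> //.
rewrite (_ : g theta theta%:C = 1) ?scale1r // /g.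
rewrite (_ : _ + _ = 0) ?cexp0 //.
by apply: complex_ext => /=; ring.
Qed.

End InterpolationBounds.

(** * The inner product of square-summable sequences *)

Section HilbertSequence.
Variable R : realType.
Implicit Types (x y z : l2 R) (u v : nat -> R[i]) (c : R[i]).

Definition csummable u : Prop :=
  cvgn (series (fun k => complex.Re (u k))) /\
  cvgn (series (fun k => complex.Im (u k))).

Lemma csummable_normc u : cvgn (series (fun k => normc (u k))) -> csummable u.
Proof.
move=> cu; split; apply: normed_cvg.
  apply: series_le_cvg cu => k; rewrite ?normr_ge0 ?normc_ge0//;
    exact: Re_le_normc.
apply: series_le_cvg cu => k; rewrite ?normr_ge0 ?normc_ge0//;
  exact: Im_le_normc.
Qed.

Lemma csum_linear c u v : csummable u -> csummable v ->
  csum (fun k => c * u k + v k) = c * csum u + csum v.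
Proof.
case: c => a b [ur ui] [vr vi].
have cZ (h : nat -> R) (r : R) : cvgn (series h) -> cvgn (series (r *: h)).
  by move=> ch; exact: is_cvg_seriesZ.
apply: complex_ext => /=.
- rewrite (_ : (fun k => _) = a *: (fun k => complex.Re (u k))
     - b *: (fun k => complex.Im (u k)) + (fun k => complex.Re (v k)));
       last first.
    by apply/funext => k; rewrite !fctE; case: (u k) (v k) => [? ?] [].
  have cB := is_cvg_seriesB (cZ _ a ur) (cZ _ b ui).
  by rewrite (lim_seriesD cB vr) (lim_seriesB (cZ _ a ur) (cZ _ b ui))
    (lim_seriesZ a ur) (lim_seriesZ b ui).
- rewrite (_ : (fun k => _) = a *: (fun k => complex.Im (u k))
     + b *: (fun k => complex.Re (u k)) + (fun k => complex.Im (v k)));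
       last first.
    by apply/funext => k; rewrite !fctE; case: (u k) (v k) => [? ?] [].
  have cD := is_cvg_seriesD (cZ _ a ui) (cZ _ b ur).
  by rewrite (lim_seriesD cD vi) (lim_seriesD (cZ _ a ui) (cZ _ b ur))
    (lim_seriesZ a ui) (lim_seriesZ b ur).
Qed.

Lemma l2_sqsummable x : cvgn (series (fun k => normc (x k) ^+ 2)).
Proof. by apply/sqsummableP; exact: l2P. Qed.

Lemma normcC c : normc (c^*%R) = normc c.
Proof. by case: c => a b; rewrite /= sqrrN. Qed.

Lemma l2dot_summable x y : csummable (fun k => x k * (y k)^*%R).
Proof.
apply: csummable_normc.
apply: (@series_le_cvg _ _ (fun k => normc (x k) ^+ 2 + normc (y k) ^+ 2)).
- by move=> k; exact: normc_ge0.
- by move=> k; rewrite addr_ge0 ?sqr_ge0.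
- move=> k; rewrite Normc.normcM normcC.
  have := sqr_ge0 (normc (x k) - normc (y k)); have :=
    sqr_ge0 (normc (x k) + normc (y k)).
  by move: (normc (x k)) (normc (y k)) => a b; clear; nra.
have -> : (fun k => normc (x k) ^+ 2 + normc (y k) ^+ 2)
    = (fun k => normc (x k) ^+ 2) + (fun k => normc (y k) ^+ 2) by [].
by apply: is_cvg_seriesD; exact: l2_sqsummable.
Qed.

Lemma l2dot_linear c x y z : l2dot (c *: x + y) z = c * l2dot x z + l2dot y z.
Proof.
rewrite /l2dot -(csum_linear _ (l2dot_summable x z) (l2dot_summable y z)).
by congr csum; apply/funext => k; rewrite mulrDl mulrA.
Qed.

Lemma l2dot0 z : l2dot 0 z = 0.
Proof.
have := l2dot_linear 1 0 0 z; rewrite scale1r addr0 mul1r.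
by move=> /eqP; rewrite -subr_eq0 opprD addrA subrr sub0r oppr_eq0 => /eqP.
Qed.

Lemma l2dotZ c x z : l2dot (c *: x) z = c * l2dot x z.
Proof. by have := l2dot_linear c x 0 z; rewrite !addr0 l2dot0 addr0. Qed.

Lemma l2dotD x y z : l2dot (x + y) z = l2dot x z + l2dot y z.
Proof. by have := l2dot_linear 1 x y z; rewrite scale1r mul1r. Qed.

Lemma l2dotB x y z : l2dot (x - y) z = l2dot x z - l2dot y z.
Proof. by rewrite -scaleN1r addrC l2dot_linear mulN1r addrC. Qed.

Lemma l2dotC x y : l2dot y x = (l2dot x y)^*%R.
Proof.
have [cr ci] := l2dot_summable x y.
have ReC (a b : R[i]) : complex.Re (b * a^*%R) = complex.Re (a * b^*%R).
  by case: a b => [? ?] [? ?] /=; ring.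
have ImC (a b : R[i]) : complex.Im (b * a^*%R) = - complex.Im (a * b^*%R).
  by case: a b => [? ?] [? ?] /=; ring.
apply: complex_ext => /=.
  by congr (limn (series _)); apply/funext => k; exact: ReC.
have -> : (fun k => complex.Im (y k * (x k)^*%R)) =
    (-1 : R) *: (fun k => complex.Im (x k * (y k)^*%R)).
  by apply/funext => k; rewrite ImC; exact/esym/mulN1r.
by rewrite lim_seriesZ// scaleN1r.
Qed.

Lemma l2norm_ge0 x : 0 <= l2norm x.
Proof. exact: sqrtr_ge0. Qed.

Lemma l2norm_sq x : l2norm x ^+ 2 = limn (series (fun k => normc (x k) ^+ 2)).
Proof.
rewrite sqr_sqrtr //; apply: limr_ge; first exact: l2_sqsummable.
by apply: nearW => n; apply: sumr_ge0 => k _; exact: sqr_ge0.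
Qed.

Lemma normc_sq c : c * c^*%R = (normc c ^+ 2)%:C.
Proof.
case: c => a b; apply: complex_ext; rewrite /=; last by ring.
by rewrite sqr_sqrtr ?addr_ge0 ?sqr_ge0//; ring.
Qed.

Lemma l2dotxx x : l2dot x x = (l2norm x ^+ 2)%:C.
Proof.
rewrite l2norm_sq; apply: complex_ext => /=.
  by congr (limn (series _)); apply/funext => k; rewrite normc_sq.
rewrite (_ : series _ = fun=> 0); first exact: (@lim_cst R).
apply/funext => n; rewrite /series /= big1// => k _.
by rewrite normc_sq.
Qed.

Lemma l2norm_sqE x : l2norm x ^+ 2 = complex.Re (l2dot x x).
Proof. by rewrite l2dotxx. Qed.

Lemma l2norm0 : l2norm (0 : l2 R) = 0.
Proof.
by apply/eqP; rewrite -sqrf_eq0 l2norm_sqE l2dot0.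
Qed.

Let conjcM (a b : R[i]) : (a * b)^*%R = a^*%R * b^*%R.
Proof. exact: rmorphM. Qed.

Let conjcD (a b : R[i]) : (a + b)^*%R = a^*%R + b^*%R.
Proof. exact: rmorphD. Qed.

Let conjcB (a b : R[i]) : (a - b)^*%R = a^*%R - b^*%R.
Proof. exact: rmorphB. Qed.

Lemma l2dot_linearr c x y z : l2dot z (c *: x + y) = c^*%R * l2dot z x + l2dot
  z y.
Proof. by rewrite l2dotC l2dot_linear conjcD conjcM -!l2dotC. Qed.

Lemma l2dotBr x y z : l2dot z (x - y) = l2dot z x - l2dot z y.
Proof. by rewrite l2dotC l2dotB conjcB -!l2dotC. Qed.

Lemma l2dot_sumr n (c : 'I_n -> R[i]) (e : 'I_n -> l2 R) x :
  l2dot x (\sum_i c i *: e i) = \sum_i (c i)^*%R * l2dot x (e i).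
Proof.
apply: (big_rec2 (fun a b => l2dot x a = b)).
  by rewrite l2dotC l2dot0 rmorph0.
by move=> i a b _ <-; rewrite l2dot_linearr.
Qed.

Lemma l2dot_suml n (c : 'I_n -> R[i]) (e : 'I_n -> l2 R) x :
  l2dot (\sum_i c i *: e i) x = \sum_i c i * l2dot (e i) x.
Proof.
apply: (big_rec2 (fun a b => l2dot a x = b)); first exact: l2dot0.
by move=> i a b _ <-; rewrite l2dot_linear.
Qed.

(** The square of the norm of [x] minus its projection [p] is nonnegative. *)
Theorem bessel n (e : 'I_n -> l2 R) x : l2_orthonormal e ->
  \sum_i normc (l2dot x (e i)) ^+ 2 <= l2norm x ^+ 2.
Proof.
move=> oe; pose p := \sum_i l2dot x (e i) *: e i.
pose S := \sum_i normc (l2dot x (e i)) ^+ 2.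
have xp : l2dot x p = S%:C.
  rewrite l2dot_sumr rmorph_sum /=; apply: eq_bigr => i _.
  by rewrite mulrC normc_sq.
have pp : l2dot p p = S%:C.
  rewrite /p l2dot_suml rmorph_sum /=; apply: eq_bigr => i _.
  rewrite l2dot_sumr (bigD1 i) //= big1 ?addr0 => [|j ji].
    by rewrite oe eqxx mulr1 normc_sq.
  by rewrite oe eq_sym (negbTE ji) mulr0.
have px : l2dot p x = S%:C by rewrite l2dotC xp; apply: complex_ext;
  rewrite /= ?oppr0.
have := sqr_ge0 (l2norm (x - p)).
rewrite (l2norm_sqE (x - p)) l2dotB !l2dotBr xp pp px subrr subr0 l2dotxx
  -rmorphB /=.
by rewrite subr_ge0.
Qed.

Lemma l2_orthonormal_norm1 n (e : 'I_n -> l2 R) i : l2_orthonormal e ->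
  l2norm (e i) = 1.
Proof.
move=> oe; apply/eqP; rewrite -(eqrXn2 (n := 2)) ?l2norm_ge0 ?ler01//.
by rewrite expr1n l2norm_sqE oe eqxx.
Qed.

Lemma l2normZ c x : l2norm (c *: x) = normc c * l2norm x.
Proof.
apply/eqP; rewrite -(eqrXn2 (n := 2)) ?mulr_ge0 ?l2norm_ge0 ?normc_ge0//;
  apply/eqP.
rewrite l2norm_sqE l2dotZ l2dotC l2dotZ conjcM -l2dotC mulrA normc_sq l2dotxx.
by rewrite -rmorphM /= exprMn.
Qed.

Lemma l2dot_le x y : l2norm y = 1 -> normc (l2dot x y) <= l2norm x.
Proof.
move=> y1; pose e := fun _ : 'I_1 => y.
have oe : l2_orthonormal e.
  by move=> i j; rewrite !ord1 eqxx /e l2dotxx y1 expr1n.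
have := bessel x oe; rewrite big_ord1.
by rewrite ler_pXn2r ?nnegrE ?normc_ge0 ?l2norm_ge0.
Qed.

Lemma coord0_le x : normc (x 0%N) <= l2norm x.
Proof.
rewrite -(@ler_pXn2r _ 2) ?nnegrE ?normc_ge0 ?l2norm_ge0// l2norm_sq.
have nd : nondecreasing_seq (series (fun k => normc (x k) ^+ 2)).
  by apply/nondecreasing_seqP => n; rewrite /series /= big_nat_recr //= lerDl
    sqr_ge0.
have := nondecreasing_cvgn_le nd (@l2_sqsummable x) 1%N.
by rewrite /series /= big_nat1.
Qed.

Lemma l2norm_e0 : l2norm (l2e0 R) = 1.
Proof.
apply/eqP; rewrite -(eqrXn2 (n := 2)) ?l2norm_ge0 ?ler01//; apply/eqP.
rewrite l2norm_sq expr1n.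
apply: cvg_lim => //; rewrite -cvg_shiftS /=.
rewrite (_ : (fun n => _) = fun=> 1); first exact: cvg_cst.
apply/funext => n; rewrite /series /= big_nat_recl //.
rewrite (_ : normc _ = 1) ?expr1n; last exact: Normc.normc1.
rewrite big1 ?addr0 // => i _.
by rewrite (_ : normc _ = 0) ?expr0n //; exact: Normc.normc0.
Qed.

Fact l2conj_subproof x : (fun k => (x k)^*%R) \in sqsummable (R := R).
Proof.
apply/sqsummableP.
have -> : (fun k => normc ((x k)^*%R) ^+ 2) = (fun k => normc (x k) ^+ 2).
  by apply/funext => k; rewrite normcC.
exact: l2_sqsummable.
Qed.

Definition l2conj x : l2 R := L2 (l2conj_subproof x).

Lemma l2norm_conj x : l2norm (l2conj x) = l2norm x.
Proof.
by congr (Num.sqrt (limn (series _))); apply/funext => k; rewrite /= normcC.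
Qed.

(** Pairing without conjugation occurs in the operators of the row space. *)
Lemma csum_mulE x y : csum (fun j => x j * y j) = l2dot x (l2conj y).
Proof. by congr csum; apply/funext => k /=; rewrite conjCK. Qed.

End HilbertSequence.

(** * Operator norms of scalar matrices *)

Section MatrixOperatorNorm.
Variable R : realType.
Implicit Types (m n k : nat).

Lemma cauchy_schwarz_sum (I : finType) (a b : I -> R) :
  (\sum_i a i * b i) ^+ 2 <= (\sum_i a i ^+ 2) * (\sum_i b i ^+ 2).
Proof.
set S := \sum_i a i * b i; set A := \sum_i a i ^+ 2; set B := \sum_i b i ^+ 2.
have B0 : 0 <= B by apply: sumr_ge0 => i _; exact: sqr_ge0.
move: B0; rewrite le_eqVlt => /predU1P[B0|B0].
  have bi i : b i = 0.
    apply/eqP; rewrite -sqrf_eq0; move/esym/eqP: B0.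
    by rewrite psumr_eq0 => [/allP/(_ i)|j _];
      rewrite ?mem_index_enum ?sqr_ge0 //; apply.
  by rewrite -B0 mulr0 /S big1 ?expr0n // => i _; rewrite bi mulr0.
(* B * a - S * b is B times the component of a orthogonal to b. *)
have : 0 <= \sum_i (B * a i - S * b i) ^+ 2 by apply: sumr_ge0 => i _;
  exact: sqr_ge0.
have -> : \sum_i (B * a i - S * b i) ^+ 2 = B * (A * B - S ^+ 2).
  have -> : \sum_i (B * a i - S * b i) ^+ 2 =
      \sum_i (B ^+ 2 * a i ^+ 2 + (- (2 * B * S) * (a i * b i) + S ^+ 2 * b i
        ^+ 2)).
    by apply: eq_bigr => i _; ring.
  by rewrite !big_split /= -!mulr_sumr -/S -/A -/B; ring.
by rewrite pmulr_rge0 // subr_ge0.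
Qed.

Lemma normc_sum_le (I : finType) (a : I -> R[i]) :
  normc (\sum_i a i) <= \sum_i normc (a i).
Proof.
apply: (big_rec2 (fun x y => normc x <= y)); first by rewrite Normc.normc0.
by move=> i x y _ h; apply: (le_trans (le_normcD _ _)); rewrite lerD2l.
Qed.

Lemma normc_sum_mul_sq_le (I : finType) (a b : I -> R[i]) :
  normc (\sum_i a i * b i) ^+ 2
    <= (\sum_i normc (a i) ^+ 2) * (\sum_i normc (b i) ^+ 2).
Proof.
apply: le_trans (cauchy_schwarz_sum (fun i => normc (a i)) (fun i =>
  normc (b i))).
rewrite ler_pXn2r ?nnegrE ?normc_ge0 //; last first.
  by apply: sumr_ge0 => i _; rewrite mulr_ge0 ?normc_ge0.
apply: (le_trans (normc_sum_le _)); apply: ler_sum => i _.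
by rewrite Normc.normcM.
Qed.

Lemma cvnorm_ge0 n (v : 'cV[R[i]]_n) : 0 <= cvnorm v.
Proof. exact: sqrtr_ge0. Qed.

Lemma cvnorm_sq n (v : 'cV[R[i]]_n) : cvnorm v ^+ 2 = \sum_i normc (v i ord0)
  ^+ 2.
Proof. by rewrite sqr_sqrtr //; apply: sumr_ge0 => i _; exact: sqr_ge0. Qed.

Lemma le_of_sq (a b : R) : 0 <= b -> a ^+ 2 <= b ^+ 2 -> a <= b.
Proof.
move=> b0 ab; have [a0|a0] := leP 0 a; last by rewrite ltW // (lt_le_trans a0).
by rewrite -(@ler_pXn2r _ 2).
Qed.

Lemma cvnorm0 n : cvnorm (0 : 'cV[R[i]]_n) = 0.
Proof.
apply/eqP; rewrite -sqrf_eq0 cvnorm_sq big1 // => i _.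
by rewrite mxE Normc.normc0 expr0n.
Qed.

Lemma cvnormZ n (c : R[i]) (v : 'cV[R[i]]_n) :
  cvnorm (c *: v) = normc c * cvnorm v.
Proof.
apply/eqP; rewrite -(eqrXn2 (n := 2)) ?mulr_ge0 ?normc_ge0 ?cvnorm_ge0 //.
rewrite exprMn !cvnorm_sq mulr_sumr; apply/eqP/eq_bigr => i _.
by rewrite mxE Normc.normcM exprMn.
Qed.

Lemma cvnorm_eq0 n (v : 'cV[R[i]]_n) : cvnorm v = 0 -> v = 0.
Proof.
move=> v0; apply/matrixP => i j; rewrite !mxE (ord1 j).
have := cvnorm_sq v; rewrite v0 expr0n /= => /esym/eqP.
rewrite psumr_eq0 => [/allP/(_ i)|k _]; rewrite ?mem_index_enum ?sqr_ge0 //.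
by move=> /(_ isT); rewrite sqrf_eq0 => /eqP/Normc.eq0_normc.
Qed.

Lemma cvnormD n (u v : 'cV[R[i]]_n) : cvnorm (u + v) <= cvnorm u + cvnorm v.
Proof.
apply: le_of_sq; first by rewrite addr_ge0 ?cvnorm_ge0.
rewrite sqrrD !cvnorm_sq.
apply: (@le_trans _ _ (\sum_i (normc (u i ord0) + normc (v i ord0)) ^+ 2)).
  apply: ler_sum => i _; rewrite mxE ler_pXn2r ?nnegrE ?addr_ge0 ?normc_ge0 //.
  exact: le_normcD.
have -> : \sum_i (normc (u i ord0) + normc (v i ord0)) ^+ 2 =
    \sum_i (normc (u i ord0) ^+ 2 + (2 * (normc (u i ord0) * normc (v i ord0))
       + normc (v i ord0) ^+ 2)) by apply: eq_bigr => i _; ring.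
rewrite !big_split /= -mulr_sumr -addrA lerD2l lerD2r -[leRHS]mulr_natl
  ler_wpM2l //.
apply: le_of_sq; first by rewrite mulr_ge0 ?cvnorm_ge0.
by rewrite exprMn !cvnorm_sq; exact: cauchy_schwarz_sum.
Qed.

Lemma cvnorm_coord_le n (v : 'cV[R[i]]_n) i : normc (v i ord0) <= cvnorm v.
Proof.
apply: le_of_sq; first exact: cvnorm_ge0.
rewrite cvnorm_sq (bigD1 i) //= lerDl; apply: sumr_ge0 => j _; exact: sqr_ge0.
Qed.

Lemma cvnorm_delta n (i : 'I_n) : cvnorm (delta_mx i ord0 : 'cV[R[i]]_n) = 1.
Proof.
apply/eqP; rewrite -(eqrXn2 (n := 2)) ?ler01 ?cvnorm_ge0 // cvnorm_sq expr1n.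
rewrite (bigD1 i) //= big1 ?addr0 => [|j ji]; rewrite mxE ?eqxx ?(negbTE ji).
  by rewrite Normc.normc1 expr1n.
by rewrite Normc.normc0 expr0n.
Qed.

Lemma cvnorm_mxcol_sq k (p : 'I_k -> nat) (w : forall i, 'cV[R[i]]_(p i)) :
  cvnorm (\mxcol_i w i) ^+ 2 = \sum_i cvnorm (w i) ^+ 2.
Proof.
rewrite cvnorm_sq; under [RHS]eq_bigr do rewrite cvnorm_sq.
rewrite sig_big_dep /= (reindex _ tagnat.sig_bij_on) /=.
by apply: eq_bigr => s _; rewrite mxE.
Qed.

Lemma cvnorm_col_mx_sq m n (u : 'cV[R[i]]_m) (v : 'cV[R[i]]_n) :
  cvnorm (col_mx u v) ^+ 2 = cvnorm u ^+ 2 + cvnorm v ^+ 2.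
Proof.
rewrite !cvnorm_sq big_split_ord /=; congr (_ + _); apply: eq_bigr => i _.
  by rewrite col_mxEu.
by rewrite col_mxEd.
Qed.

Lemma cvnorm_mul_le_frobenius m n (a : 'M[R[i]]_(m, n)) v :
  cvnorm (a *m v) <= Num.sqrt (\sum_i \sum_j normc (a i j) ^+ 2) * cvnorm v.
Proof.
have F0 : 0 <= \sum_i \sum_j normc (a i j) ^+ 2.
  by apply: sumr_ge0 => i _; apply: sumr_ge0 => j _; exact: sqr_ge0.
apply: le_of_sq; first by rewrite mulr_ge0 ?sqrtr_ge0 ?cvnorm_ge0.
rewrite exprMn (sqr_sqrtr F0) !cvnorm_sq mulr_suml; apply: ler_sum => i _.
by rewrite mxE; exact: normc_sum_mul_sq_le.
Qed.

Lemma mxopnorm_le m n (a : 'M[R[i]]_(m, n)) (K : R) : 0 <= K ->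
  (forall v, cvnorm (a *m v) <= K * cvnorm v) -> (mxopnorm a <= K%:E)%E.
Proof.
move=> K0 aK; apply: ge_ereal_sup => _ [v v1 <-]; rewrite lee_fin.
by apply: (le_trans (aK v)); rewrite ler_piMr.
Qed.

Lemma cvnorm_le_mxopnorm m n (a : 'M[R[i]]_(m, n)) v : cvnorm v <= 1 ->
  ((cvnorm (a *m v))%:E <= mxopnorm a)%E.
Proof. by move=> v1; apply: ereal_sup_ubound; exists v. Qed.

Definition opn m n (a : 'M[R[i]]_(m, n)) : R := fine (mxopnorm a).

Lemma mxopnormE m n (a : 'M[R[i]]_(m, n)) : mxopnorm a = (opn a)%:E.
Proof.
rewrite fineK // ge0_fin_numE.
  apply: (@le_lt_trans _ _ (Num.sqrt (\sum_i \sum_j normc (a i j) ^+ 2))%:E).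
    by apply: mxopnorm_le; [exact: sqrtr_ge0|exact: cvnorm_mul_le_frobenius].
  exact: ltry.
have := @cvnorm_le_mxopnorm _ _ a 0; rewrite mulmx0 !cvnorm0; apply;
  exact: ler01.
Qed.

Lemma opn_ge0 m n (a : 'M[R[i]]_(m, n)) : 0 <= opn a.
Proof.
rewrite -lee_fin -mxopnormE.
have := @cvnorm_le_mxopnorm _ _ a 0; rewrite mulmx0 !cvnorm0; apply;
  exact: ler01.
Qed.

Lemma opn_apply m n (a : 'M[R[i]]_(m, n)) v :
  cvnorm (a *m v) <= opn a * cvnorm v.
Proof.
have [v0|v0] := eqVneq (cvnorm v) 0.
  by rewrite v0 mulr0 (cvnorm_eq0 v0) mulmx0 cvnorm0.
have vp : 0 < cvnorm v by rewrite lt_neqAle eq_sym v0 cvnorm_ge0.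
have nV : normc ((cvnorm v)^-1)%:C = (cvnorm v)^-1.
  by rewrite normc_real ger0_norm // invr_ge0 cvnorm_ge0.
have := @cvnorm_le_mxopnorm _ _ a (((cvnorm v)^-1)%:C *: v).
rewrite mxopnormE lee_fin -scalemxAr !cvnormZ nV mulVf // => /(_ (lexx _)).
by rewrite mulrC ler_pdivrMr.
Qed.

Lemma opn_le m n (a : 'M[R[i]]_(m, n)) (K : R) : 0 <= K ->
  (forall v, cvnorm (a *m v) <= K * cvnorm v) -> opn a <= K.
Proof. by move=> K0 /(mxopnorm_le K0); rewrite mxopnormE lee_fin. Qed.

Lemma mxopnorm_row_le n (a : 'rV[R[i]]_n) (v : 'cV[R[i]]_n) :
  (forall i, normc (a ord0 i) = normc (v i ord0)) ->
    (mxopnorm a <= (cvnorm v)%:E)%E.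
Proof.
move=> av; apply: mxopnorm_le; first exact: cvnorm_ge0.
move=> w; apply: le_of_sq; first by rewrite mulr_ge0 ?cvnorm_ge0.
rewrite exprMn !cvnorm_sq big_ord1 mxE (eq_bigr (fun i =>
  normc (a ord0 i) ^+ 2)).
  exact: normc_sum_mul_sq_le.
by move=> i _; rewrite av.
Qed.

Lemma mxopnorm_col_le n (v : 'cV[R[i]]_n) : (mxopnorm v <= (cvnorm v)%:E)%E.
Proof.
apply: mxopnorm_le; first exact: cvnorm_ge0.
move=> w; have -> : v *m w = w ord0 ord0 *: v.
  by apply/matrixP => i j; rewrite !mxE big_ord1 (ord1 j) mulrC.
rewrite cvnormZ mulrC ler_wpM2l ?cvnorm_ge0 //; exact: cvnorm_coord_le.
Qed.

End MatrixOperatorNorm.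

(** * First columns in the row and column spaces *)

Section RowColumn.
Variable R : realType.
Implicit Types (x : l2 R) (n k : nat).

Lemma l2tnorm_sq n (xi : 'I_n -> l2 R) : l2tnorm xi ^+ 2 = \sum_i l2norm (xi i)
  ^+ 2.
Proof. by rewrite sqr_sqrtr //; apply: sumr_ge0 => i _; exact: sqr_ge0. Qed.

Lemma l2tnorm_ge0 n (xi : 'I_n -> l2 R) : 0 <= l2tnorm xi.
Proof. exact: sqrtr_ge0. Qed.

Lemma l2norm_le_l2tnorm n (xi : 'I_n -> l2 R) i : l2norm (xi i) <= l2tnorm xi.
Proof.
apply: le_of_sq; first exact: l2tnorm_ge0.
rewrite l2tnorm_sq (bigD1 i) //= lerDl; apply: sumr_ge0 => j _; exact: sqr_ge0.
Qed.

Lemma Bl2_ge n (T : 'M[l2 R -> l2 R]_n) xi : l2tnorm xi <= 1 ->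
  ((l2tnorm (fun i => \sum_(j < n) T i j (xi j)))%:E <= Bl2 T)%E.
Proof. by move=> xi1; apply: ereal_sup_ubound; exists xi. Qed.

Lemma Bl2_le n (T : 'M[l2 R -> l2 R]_n) (K : R) :
  (forall xi, l2tnorm xi <= 1 ->
     l2tnorm (fun i => \sum_(j < n) T i j (xi j)) <= K) ->
  (Bl2 T <= K%:E)%E.
Proof. by move=> h; apply: ge_ereal_sup => _ [xi xi1 <-]; rewrite lee_fin;
  exact: h. Qed.

Lemma ropE x (xi : l2 R) : rop x xi = l2dot x (l2conj xi) *: l2e0 R.
Proof. by rewrite /rop csum_mulE. Qed.

Lemma sum_first_col n (F : l2 R -> l2 R -> l2 R) (v : 'I_n.+1 -> l2 R) xi i :
  (forall eta, F 0 eta = 0) ->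
  \sum_(j < n.+1) map_mx F (first_col v) i j (xi j) = F (v i) (xi ord0).
Proof.
move=> F0; rewrite big_ord_recl big1 ?addr0; first by rewrite !mxE.
by move=> j _; rewrite !mxE.
Qed.

(** Applied to [xi], the column of row operators [e i] produces the coefficients
    of the conjugate of [xi] on the orthonormal family: this is Bessel's
    inequality. *)
Lemma Rsp_first_col_le n (e : 'I_n.+1 -> l2 R) (c : R[i]) : l2_orthonormal e ->
  (Rsp (first_col (fun i => c *: e i)) <= (normc c)%:E)%E.
Proof.
move=> oe; apply: Bl2_le => xi xi1.
apply: le_of_sq; first exact: normc_ge0.
rewrite l2tnorm_sq.
have E i : l2norm (\sum_(j < n.+1) map_mx (@rop R) (first_col (fun i =>
  c *: e i)) i j (xi j))
    = normc c * normc (l2dot (l2conj (xi ord0)) (e i)).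
  rewrite sum_first_col; last by move=> eta; rewrite ropE l2dot0 scale0r.
  by rewrite ropE l2normZ l2norm_e0 mulr1 l2dotZ Normc.normcM [l2dot (e i)
    _]l2dotC normcC.
under eq_bigr do rewrite E exprMn.
rewrite -mulr_sumr ler_piMr ?sqr_ge0 //.
apply: (le_trans (bessel _ oe)); rewrite l2norm_conj.
rewrite expr_le1 ?l2norm_ge0 //; exact: le_trans (l2norm_le_l2tnorm _ _) xi1.
Qed.

Lemma Csp_first_col_le n (e : 'I_n.+1 -> l2 R) (c : R[i]) : l2_orthonormal e ->
  (Csp (first_col (fun i => c *: e i)) <= (Num.sqrt n.+1%:R * normc c)%:E)%E.
Proof.
move=> oe; apply: Bl2_le => xi xi1.
apply: le_of_sq; first by rewrite mulr_ge0 ?sqrtr_ge0 ?normc_ge0.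
rewrite l2tnorm_sq exprMn sqr_sqrtr ?ler0n//.
have E i : l2norm (\sum_(j < n.+1) map_mx (@cop R) (first_col (fun i =>
  c *: e i)) i j (xi j))
    = normc (xi ord0 0%N) * normc c.
  rewrite sum_first_col; last by move=> eta; rewrite /cop scaler0.
  by rewrite /cop !l2normZ (l2_orthonormal_norm1 i oe) mulr1.
under eq_bigr do rewrite E exprMn.
rewrite sumr_const card_ord -[leLHS]mulr_natl ler_wpM2l ?ler0n // ler_piMl
  ?sqr_ge0 //.
rewrite expr_le1 ?normc_ge0 //; apply: (le_trans (coord0_le _)).
exact: le_trans (l2norm_le_l2tnorm _ _) xi1.
Qed.

(** Functionals are completely contractive on [R]: the vectors [v j] times the
    conjugate of [e] turn the operator matrix [y] into the scalar matrix of
    inner products. *)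
Lemma mxopnorm_dot_le_Rsp k (y : 'M[l2 R]_k) e : l2norm e = 1 ->
  (mxopnorm (map_mx (fun x => l2dot x e) y) <= Rsp y)%E.
Proof.
move=> e1; apply: ge_ereal_sup => _ [v v1 <-].
pose xi j := v j ord0 *: l2conj e.
have vE : l2tnorm xi = cvnorm v.
  congr Num.sqrt; apply: eq_bigr => i _.
  by rewrite /xi l2normZ l2norm_conj e1 mulr1.
have xi1 : l2tnorm xi <= 1 by rewrite vE.
apply: le_trans (Bl2_ge _ xi1); rewrite lee_fin le_eqVlt; apply/orP; left;
  apply/eqP.
congr Num.sqrt; apply: eq_bigr => i _; congr (_ ^+ 2).
have -> : \sum_(j < k) map_mx (@rop R) y i j (xi j)
    = (map_mx (fun x => l2dot x e) y *m v) i ord0 *: l2e0 R.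
  rewrite mxE scaler_suml; apply: eq_bigr => j _; rewrite !mxE /rop;
    congr (_ *: _).
  rewrite csum_mulE.
  have -> : l2conj (xi j) = (v j ord0)^*%R *: e.
    by apply/val_inj/funext => m; rewrite /= rmorphM /= conjCK.
  by have := l2dot_linearr (v j ord0)^*%R e 0 (y i j); rewrite addr0 => ->;
    rewrite conjCK [l2dot _ 0]l2dotC l2dot0 rmorph0 addr0 mulrC.
by rewrite l2normZ l2norm_e0 mulr1.
Qed.

(** On [C] the vectors [v j] times the first basis vector leave the combinations
    of the entries of [y], whose inner products with [e] are not longer. *)
Lemma mxopnorm_dot_le_Csp k (y : 'M[l2 R]_k) e : l2norm e = 1 ->
  (mxopnorm (map_mx (fun x => l2dot x e) y) <= Csp y)%E.
Proof.
move=> e1; apply: ge_ereal_sup => _ [v v1 <-].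
pose xi j := v j ord0 *: l2e0 R.
have vE : l2tnorm xi = cvnorm v.
  by congr Num.sqrt; apply: eq_bigr => i _; rewrite /xi l2normZ l2norm_e0 mulr1.
have xi1 : l2tnorm xi <= 1 by rewrite vE.
apply: le_trans (Bl2_ge _ xi1); rewrite lee_fin.
apply: le_of_sq; first exact: l2tnorm_ge0.
rewrite l2tnorm_sq cvnorm_sq; apply: ler_sum => i _.
rewrite ler_pXn2r ?nnegrE ?normc_ge0 ?l2norm_ge0 //.
have -> : \sum_(j < k) map_mx (@cop R) y i j (xi j) = \sum_j v j ord0 *: y i j.
  apply: eq_bigr => j _; rewrite !mxE /cop; congr (_ *: _).
  exact: mulr1.
rewrite (_ : (_ *m _) i ord0 = l2dot (\sum_j v j ord0 *: y i j) e).
  exact: l2dot_le.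
rewrite l2dot_suml mxE; apply: eq_bigr => j _; by rewrite !mxE mulrC.
Qed.

(** The functional that certifies the lower bounds: it is 1 on [first_col e],
    with norm at most 1 on the spaces with [kappa = 1] and at most
    [1 / sqrt n] on those with [kappa = sqrt n]. *)
Definition diag_mean n (e : 'I_n.+1 -> l2 R) (y : 'M[l2 R]_n.+1) : R[i] :=
  n.+1%:R^-1 * \sum_i l2dot (y i ord0) (e i).

Lemma diag_meanB n (e : 'I_n.+1 -> l2 R) (y z : 'M[l2 R]_n.+1) :
  diag_mean e (y - z) = diag_mean e y - diag_mean e z.
Proof.
rewrite /diag_mean -mulrBr -sumrB; congr (_ * _); apply: eq_bigr => i _.
by rewrite !mxE l2dotB.
Qed.

Lemma diag_meanZ n (e : 'I_n.+1 -> l2 R) c (y : 'M[l2 R]_n.+1) :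
  diag_mean e (map_mx ( *:%R c) y) = c * diag_mean e y.
Proof.
rewrite /diag_mean [RHS]mulrCA [c * _]mulr_sumr; congr (_ * _);
  apply: eq_bigr => i _.
by rewrite !mxE l2dotZ.
Qed.

Lemma diag_mean_first_col n (e : 'I_n.+1 -> l2 R) : l2_orthonormal e ->
  diag_mean e (first_col e) = 1.
Proof.
move=> oe; rewrite /diag_mean (eq_bigr (fun=> 1)); last by move=> i _;
  rewrite mxE oe eqxx.
by rewrite sumr_const card_ord mulVf // pnatr_eq0.
Qed.

Lemma normc_natV n : normc (n.+1%:R^-1 : R[i]) = n.+1%:R^-1.
Proof.
rewrite Normc.normcV; congr (_^-1).
have -> : (n.+1%:R : R[i]) = (n.+1%:R : R)%:C by rewrite rmorph_nat.
by rewrite normc_real ger0_norm // ler0n.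
Qed.

Lemma normc_diag_mean_le n (e : 'I_n.+1 -> l2 R) (y : 'M[l2 R]_n.+1) (M :
  \bar R) :
  (forall i, ((normc (l2dot (y i ord0) (e i)))%:E <= M)%E) ->
  ((normc (diag_mean e y))%:E <= M)%E.
Proof.
case: M => [M| |] h; [|exact: leey|by have := h ord0].
rewrite lee_fin /diag_mean Normc.normcM normc_natV mulrC ler_pdivrMr ?ltr0n //.
apply: (le_trans (normc_sum_le _)); rewrite mulr_natr -[n.+1 in leRHS]card_ord
  -sumr_const.
by apply: ler_sum => i _; rewrite -lee_fin.
Qed.

Lemma sqrt_normc_diag_mean_le n (e : 'I_n.+1 -> l2 R) (y : 'M[l2 R]_n.+1) :
  Num.sqrt n.+1%:R * normc (diag_mean e y)
    <= Num.sqrt (\sum_i normc (l2dot (y i ord0) (e i)) ^+ 2).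
Proof.
apply: le_of_sq; first exact: sqrtr_ge0.
rewrite exprMn !sqr_sqrtr ?ler0n//; last by apply: sumr_ge0 => i _;
  exact: sqr_ge0.
rewrite /diag_mean Normc.normcM normc_natV.
have := normc_sum_mul_sq_le (fun i => l2dot (y i ord0) (e i)) (fun=> 1).
under eq_bigr do rewrite mulr1.
rewrite Normc.normc1 expr1n sumr_const card_ord => h.
have n0 : (n.+1%:R : R) != 0 by rewrite pnatr_eq0.
by rewrite exprMn expr2 mulrA mulrA mulfV // mul1r mulrC ler_pdivrMr ?ltr0n //.
Qed.

Lemma diag_mean_le_Csp n (e : 'I_n.+1 -> l2 R) (y : 'M[l2 R]_n.+1) :
  l2_orthonormal e ->
  ((Num.sqrt n.+1%:R * normc (diag_mean e y))%:E <= Csp y)%E.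
Proof.
move=> oe.
pose xi (j : 'I_n.+1) : l2 R := (j == ord0)%:R *: l2e0 R.
have xi1 : l2tnorm xi <= 1.
  apply: le_of_sq => //; rewrite l2tnorm_sq expr1n (bigD1 ord0) //= big1 ?addr0.
    by rewrite /xi eqxx scale1r l2norm_e0 expr1n.
  by move=> j /negbTE j0; rewrite /xi j0 scale0r l2norm0 expr0n.
apply: le_trans (Bl2_ge _ xi1); rewrite lee_fin.
apply: (le_trans (sqrt_normc_diag_mean_le _ _)).
rewrite ler_wsqrtr //; apply: ler_sum => i _.
rewrite ler_pXn2r ?nnegrE ?normc_ge0 ?l2norm_ge0 //.
rewrite (_ : \sum_(j < n.+1) _ = y i ord0); first by apply: l2dot_le;
  exact: l2_orthonormal_norm1.
rewrite big_ord_recl big1 ?addr0 => [|j _]; rewrite !mxE /cop /xi /=.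
  by rewrite scale1r /= scale1r.
by rewrite scale0r scale0r.
Qed.

End RowColumn.

(** * The scalars as an operator space *)

Section ScalarOperatorSpace.
Variable R : realType.
Implicit Types (m n k : nat).

(** The target of the functionals that bound the norm of [R + C] from below. *)
Definition scalar_opspace : matnorm R (R[i]^o) := fun n x => mxopnorm (x :
  'M[R[i]]_n).

Lemma opn_delta_entry n (a : 'M[R[i]]_n) i j : normc (a i j) <= opn a.
Proof.
have := opn_apply a (delta_mx j ord0); rewrite cvnorm_delta mulr1.
apply: le_trans; rewrite -colE; apply: le_trans (cvnorm_coord_le _ i).
by rewrite mxE.
Qed.

Lemma opn_eq0 n (a : 'M[R[i]]_n) : opn a = 0 -> a = 0.
Proof.
move=> a0; apply/matrixP => i j; rewrite mxE; apply: Normc.eq0_normc; apply/eqP.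
by rewrite eq_le normc_ge0 andbT -a0 opn_delta_entry.
Qed.

Lemma opnD n (a b : 'M[R[i]]_n) : opn (a + b) <= opn a + opn b.
Proof.
apply: opn_le => [|v]; first by rewrite addr_ge0 ?opn_ge0.
rewrite mulmxDl mulrDl; apply: (le_trans (cvnormD _ _)).
by apply: lerD; exact: opn_apply.
Qed.

Lemma opnZ n (c : R[i]) (a : 'M[R[i]]_n) : opn (c *: a) = normc c * opn a.
Proof.
have le c' a' : opn (c' *: a' : 'M[R[i]]_n) <= normc c' * opn a'.
  apply: opn_le => [|v]; first by rewrite mulr_ge0 ?normc_ge0 ?opn_ge0.
  rewrite -scalemxAl cvnormZ -mulrA ler_wpM2l ?normc_ge0 //; exact: opn_apply.
apply/eqP; rewrite eq_le le /=.
have [->|c0] := eqVneq c 0; first by rewrite Normc.normc0 mul0r opn_ge0.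
have nc0 : 0 < normc c.
  rewrite lt_neqAle normc_ge0 andbT eq_sym; apply: contra c0 =>
    /eqP/Normc.eq0_normc/eqP.
  by [].
have := le c^-1 (c *: a); rewrite scalerA mulVf // scale1r Normc.normcV mulrC.
by rewrite ler_pdivlMr // mulrC.
Qed.

Lemma opnM m n k (a : 'M[R[i]]_(m, n)) (b : 'M[R[i]]_(n, k)) :
  opn (a *m b) <= opn a * opn b.
Proof.
apply: opn_le => [|v]; first by rewrite mulr_ge0 ?opn_ge0.
rewrite -mulmxA; apply: (le_trans (opn_apply _ _)).
by rewrite -mulrA ler_wpM2l ?opn_ge0 //; exact: opn_apply.
Qed.

Lemma opn_block_diag m n (a : 'M[R[i]]_m) (b : 'M[R[i]]_n) :
  opn (block_mx a 0 0 b) = Num.max (opn a) (opn b).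
Proof.
apply/eqP; rewrite eq_le ge_max; apply/and3P; split.
- set K := Num.max _ _; have K0 : 0 <= K by rewrite le_max opn_ge0.
  have aK : opn a <= K by rewrite le_max lexx.
  have bK : opn b <= K by rewrite le_max lexx orbT.
  apply: opn_le => // v; rewrite -(vsubmxK v) mul_block_col !mul0mx addr0 add0r.
  apply: le_of_sq; first by rewrite mulr_ge0 ?cvnorm_ge0.
  rewrite exprMn !cvnorm_col_mx_sq mulrDr -!exprMn.
  apply: lerD; rewrite ler_pXn2r ?nnegrE ?mulr_ge0 ?cvnorm_ge0 //.
    by apply: (le_trans (opn_apply _ _)); rewrite ler_wpM2r ?cvnorm_ge0.
  by apply: (le_trans (opn_apply _ _)); rewrite ler_wpM2r ?cvnorm_ge0.
- apply: opn_le => [|v]; first exact: opn_ge0.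
  have := opn_apply (block_mx a 0 0 b) (col_mx v 0).
  have -> : cvnorm (col_mx v (0 : 'cV_n)) = cvnorm v.
    apply/eqP; rewrite -(eqrXn2 (n := 2)) ?cvnorm_ge0 //.
    by rewrite cvnorm_col_mx_sq cvnorm0 expr0n addr0.
  rewrite mul_block_col !mul0mx !mulmx0 addr0 add0r; apply: le_trans.
  apply: le_of_sq; first exact: cvnorm_ge0.
  by rewrite cvnorm_col_mx_sq lerDl sqr_ge0.
- apply: opn_le => [|v]; first exact: opn_ge0.
  have := opn_apply (block_mx a 0 0 b) (col_mx 0 v).
  have -> : cvnorm (col_mx (0 : 'cV_m) v) = cvnorm v.
    apply/eqP; rewrite -(eqrXn2 (n := 2)) ?cvnorm_ge0 //.
    by rewrite cvnorm_col_mx_sq cvnorm0 expr0n add0r.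
  rewrite mul_block_col !mul0mx !mulmx0 addr0 add0r; apply: le_trans.
  apply: le_of_sq; first exact: cvnorm_ge0.
  by rewrite cvnorm_col_mx_sq lerDr sqr_ge0.
Qed.

Lemma opn_const1 (c : R[i]) : opn (const_mx c : 'M[R[i]]_1) = normc c.
Proof.
apply/eqP; rewrite eq_le; apply/andP; split; last first.
  by have := opn_delta_entry (const_mx c : 'M[R[i]]_1) ord0 ord0; rewrite mxE.
apply: opn_le => [|v]; first exact: normc_ge0.
rewrite -cvnormZ (_ : _ *m _ = c *: v) //.
by apply/matrixP => i j; rewrite !mxE big_ord1 !ord1 mxE.
Qed.

Lemma cauchy_real_cvg (x : nat -> R) :
  (forall e : R, 0 < e -> exists K, forall j k, (K <= j)%N -> (K <= k)%N ->
    `|x j - x k| < e) ->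
  exists l, forall e : R, 0 < e -> exists K, forall k, (K <= k)%N ->
    `|x k - l| < e.
Proof.
move=> cx; have : cvgn x.
  apply: cauchy_cvg; apply: cauchy_exP => e /cx[K hK].
  by exists (x K); exists K => // k /= Kk; apply: hK.
move=> cvx; exists (limn x) => e e0.
have /cvgrPdist_lt /(_ e e0) [K _ hK] := cvx.
by exists K => k Kk; rewrite distrC; exact: hK.
Qed.

Lemma cauchy_complex_cvg (x : nat -> R[i]) :
  (forall e : R, 0 < e ->
     exists K, forall j k, (K <= j)%N -> (K <= k)%N -> normc (x j - x k) < e) ->
  exists l, forall e : R, 0 < e -> exists K, forall k, (K <= k)%N ->
    normc (x k - l) < e.
Proof.
move=> cx.
have [|a ha] := @cauchy_real_cvg (fun k => complex.Re (x k)).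
  move=> e /cx[K hK]; exists K => j k Kj Kk; apply: le_lt_trans (hK _ _ Kj Kk).
  by apply: le_trans (Re_le_normc _); case: (x j) (x k) => [? ?] [].
have [|b hb] := @cauchy_real_cvg (fun k => complex.Im (x k)).
  move=> e /cx[K hK]; exists K => j k Kj Kk; apply: le_lt_trans (hK _ _ Kj Kk).
  by apply: le_trans (Im_le_normc _); case: (x j) (x k) => [? ?] [].
exists (a +i* b) => e e0; have e2 : 0 < e / 2 by rewrite divr_gt0.
have [K1 h1] := ha _ e2; have [K2 h2] := hb _ e2.
exists (maxn K1 K2) => k; rewrite geq_max => /andP[/h1 k1 /h2 k2].
apply: (le_lt_trans (normc_le_ReIm _)).
rewrite (_ : e = e / 2 + e / 2); last by field.
by apply: ltrD; [move: k1|move: k2]; case: (x k).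
Qed.

Theorem scalar_operator_space : operator_space scalar_opspace.
Proof.
rewrite /scalar_opspace.
split; [|split; [|split; [|split; [|split; [|split]]]]].
- by move=> n x; rewrite mxopnormE lee_fin opn_ge0 ltry.
- by move=> n x; rewrite mxopnormE => -[/opn_eq0].
- by move=> n x y; rewrite !mxopnormE -EFinD lee_fin; exact: opnD.
- move=> n c x; rewrite !mxopnormE -EFinM; congr (_%:E).
  by rewrite -opnZ; congr opn; apply/matrixP => i j; rewrite !mxE.
- move=> m n a x b; rewrite !mxopnormE -!EFinM lee_fin.
  have -> : (rmulmx (lmulmx a x) b : 'M[R[i]]_m) = a *m (x : 'M[R[i]]_n) *m b.
    apply/matrixP => i j; rewrite !mxE; apply: eq_bigr => k _.
    rewrite !mxE mulrC; congr (_ * _).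
  apply: (le_trans (opnM _ _)); rewrite ler_wpM2r ?opn_ge0 //; exact: opnM.
- move=> m n x y; rewrite !mxopnormE -EFin_max; congr (_%:E);
  exact: opn_block_diag.
- move=> x cx; have [|l hl] := @cauchy_complex_cvg x.
    move=> e /cx[K hK]; exists K => j k Kj Kk; have := hK j k Kj Kk.
    by rewrite mxopnormE lte_fin opn_const1.
  exists l => e /hl[K hK]; exists K => k /hK.
  by rewrite mxopnormE lte_fin opn_const1.
Qed.

End ScalarOperatorSpace.

(** * The quantities kappa and their interpolation *)

Section KappaEstimates.
Variable R : realType.
Implicit Types (n k : nat).

Lemma map_scale_first_col n (e : 'I_n -> l2 R) (c : R[i]) :
  map_mx ( *:%R c) (first_col e) = first_col (fun i => c *: e i).
Proof. by apply/matrixP => i j; rewrite !mxE; case: ifP => // _;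
  rewrite scaler0. Qed.

Lemma cbnorm_le (V W : Type) (N : matnorm R V) (N' : matnorm R W)
    (u : V -> W) (M : \bar R) :
  (cbnorm N N' u <= M)%E ->
  forall k (y : 'M[V]_k), (N k y <= 1)%E -> (N' k (map_mx u y) <= M)%E.
Proof.
move=> uM k y y1; apply: le_trans uM.
apply: (@le_trans _ _ (ampnorm N N' u k)); last by apply: ereal_sup_ubound;
  exists k.
by apply: ereal_sup_ubound; exists y.
Qed.

Lemma le_cbnorm (V W : Type) (N : matnorm R V) (N' : matnorm R W)
    (u : V -> W) (M : \bar R) :
  (forall k (y : 'M[V]_k), (N k y <= 1)%E -> (N' k (map_mx u y) <= M)%E) ->
  (cbnorm N N' u <= M)%E.
Proof.
move=> h; apply: ge_ereal_sup => _ [k _ <-]; apply: ge_ereal_sup => _ [y y1 <-].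
exact: h.
Qed.

Lemma Rsp_first_col_le1 n (e : 'I_n.+1 -> l2 R) : l2_orthonormal e ->
  (Rsp (first_col e) <= 1)%E.
Proof.
move=> oe; have := Rsp_first_col_le 1 oe; rewrite Normc.normc1.
by under [X in first_col X]eq_fun do rewrite scale1r.
Qed.

Definition l2dotr (e : l2 R) (x : l2 R) : R[i]^o := l2dot x e.

Fact l2dotr_is_linear e : linear (l2dotr e).
Proof. by move=> a x y; rewrite /l2dotr l2dot_linear. Qed.

HB.instance Definition _ e :=
  GRing.isLinear.Build R[i] (l2 R) R[i]^o _ (l2dotr e) (l2dotr_is_linear e).

(** The representative [(c e, 0)] already has norm at most [|c|]: a complete
    contraction out of [R] cannot increase the norm of [first_col e]. *)
Lemma RplusC_first_col_le n (e : 'I_n.+1 -> l2 R) (c : R[i]) :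
  l2_orthonormal e ->
  (RplusC (first_col (fun i => c *: e i)) <= (normc c)%:E)%E.
Proof.
move=> oe; set x := first_col _.
apply: (@le_trans _ _ (l1_sum (@Rsp R) (@Csp R) (map_mx (fun x =>
  (x, 0)) x + 0))).
  apply: ereal_inf_lbound; exists 0 => // i j; exists 0.
  by rewrite mxE oppr0.
apply: ge_ereal_sup => _ [Z [G [u [v [oG u1 v1 ->]]]]].
have [_ [_ [_ [GZ _]]]] := oG.
have -> : map_mx (fun p => u p.1 + v p.2) (map_mx (fun x => (x, 0)) x + 0)
    = map_mx ( *:%R c) (map_mx u (first_col e)).
  rewrite addr0; apply/matrixP => i j; rewrite !mxE /= linear0 addr0.
  by case: ifP => _; [rewrite linearZ|rewrite !linear0].
rewrite GZ -[leRHS]mule1; apply: lee_wpmul2l;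
  first by rewrite lee_fin normc_ge0.
exact: (cbnorm_le u1 (Rsp_first_col_le1 oe)).
Qed.

(** The functional of [e] on both summands is a pair of complete contractions
    into the scalars, and it vanishes on the antidiagonal. *)
Lemma dot_le_RplusC n (y : 'M[l2 R]_n) (e : l2 R) i j : l2norm e = 1 ->
  ((normc (l2dot (y i j) e))%:E <= RplusC y)%E.
Proof.
move=> e1; apply: le_ereal_inf_tmp => _ [d dD <-].
set p := map_mx _ y + d.
apply: (@le_trans _ _ (scalar_opspace (map_mx (fun p =>
  l2dotr e p.1 + l2dotr e p.2) p))).
  rewrite /scalar_opspace mxopnormE lee_fin.
  apply: le_trans (opn_delta_entry _ i j).
  rewrite (_ : map_mx _ p i j = l2dot (y i j) e) //.
  rewrite !mxE; have [z ->] := dD i j.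
  apply: etrans (esym (l2dotD _ _ _)) _.
  by rewrite /= add0r addrK.
apply: ereal_sup_ubound; exists R[i]^o, (@scalar_opspace R), (l2dotr e),
  (l2dotr e).
split=> //; first exact: scalar_operator_space.
  by apply: le_cbnorm => k z z1; apply: le_trans z1; exact: mxopnorm_dot_le_Rsp.
by apply: le_cbnorm => k z z1; apply: le_trans z1; exact: mxopnorm_dot_le_Csp.
Qed.

Lemma RcapCE n (x : 'M[l2 R]_n) : RcapC x = maxe (Rsp x) (Csp x).
Proof.
have E1 : map_mx fst (map_mx (fun z => (z, z)) x) = x.
  by apply/matrixP => i j; rewrite !mxE.
have E2 : map_mx snd (map_mx (fun z => (z, z)) x) = x.
  by apply/matrixP => i j; rewrite !mxE.
by rewrite {1}/RcapC {1}/pull /linf_sum E1 E2.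
Qed.

Lemma RcapC_le n (x : 'M[l2 R]_n) (K : \bar R) :
  (Rsp x <= K)%E -> (Csp x <= K)%E -> (RcapC x <= K)%E.
Proof. by move=> rK cK; rewrite (RcapCE x) ge_max; apply/andP; split;
  [exact: rK|exact: cK]. Qed.

Lemma Csp_le_RcapC n (x : 'M[l2 R]_n) : (Csp x <= RcapC x)%E.
Proof. by rewrite (RcapCE x) le_max; apply/orP; right; exact: lexx. Qed.

Lemma sqrt_nat_ge1 n : 1 <= Num.sqrt (n.+1%:R : R).
Proof. by rewrite -[leLHS]sqrtr1 ler_wsqrtr // ler1n. Qed.

Lemma sqrt_powR (x theta : R) : 0 <= x -> Num.sqrt x `^ theta = x `^ (theta /
  2).
Proof. by move=> x0; rewrite -powR12_sqrt // -powRrM mulrC. Qed.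

(** The first two conditions bound [kappa] above by 1 and [sqrt n], uniformly
    along the line of [first_col e]; the last two bound it below. *)
Theorem kappa_interp (X0 X1 : matnorm R (l2 R)) n (theta : R) :
  0 <= theta <= 1 ->
  (forall (e : 'I_n.+1 -> l2 R) (c : R[i]), l2_orthonormal e ->
     [/\ (X0 n.+1 (first_col (fun i => c *: e i)) <= (normc c)%:E)%E,
       (X1 n.+1 (first_col (fun i => c *: e i))
          <= (Num.sqrt n.+1%:R * normc c)%:E)%E,
       (forall y, ((normc (diag_mean e y))%:E <= X0 n.+1 y)%E)
     & (forall y,
         ((Num.sqrt n.+1%:R * normc (diag_mean e y))%:E <= X1 n.+1 y)%E)]) ->
  kappa_eq (interp theta X0 X1) n.+1 (n.+1%:R `^ (theta / 2)).
Proof.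
move=> t01 h e oe; rewrite -sqrt_powR ?ler0n // /interp.
apply: (@interp_norm_line R (mxmod (l2 R) n.+1) _ _ (diag_mean e)) => //.
- exact: sqrt_nat_ge1.
- by move=> c; have [+ _ _ _] := h e c oe; rewrite -map_scale_first_col.
- by move=> c; have [_ + _ _] := h e c oe; rewrite -map_scale_first_col.
- exact: diag_meanB.
- exact: diag_meanZ.
- by have [_ _ + _] := h e 0 oe.
- by have [_ _ _ +] := h e 0 oe.
- exact: diag_mean_first_col.
Qed.

Theorem kappa_RplusC_RcapC n (theta : R) : 0 <= theta <= 1 ->
  kappa_eq (interp theta (@RplusC R) (@RcapC R)) n.+1 (n.+1%:R `^ (theta / 2)).
Proof.
move=> t01; apply: kappa_interp t01 _ => e c oe; split.
- exact: (RplusC_first_col_le c oe).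
- apply: (RcapC_le _ (Csp_first_col_le c oe)).
  apply: (le_trans (Rsp_first_col_le c oe)); rewrite lee_fin.
  by rewrite ler_peMl ?normc_ge0 // sqrt_nat_ge1.
- move=> y; apply: normc_diag_mean_le => i; exact: (dot_le_RplusC _ _ _
  (l2_orthonormal_norm1 i oe)).
- by move=> y; exact: (le_trans (diag_mean_le_Csp y oe) (Csp_le_RcapC y)).
Qed.

Section OperatorSpace.
Variable X : matnorm R (l2 R).
Hypotheses (oX : operator_space X) (hX : hilbertian X).

(** The compression of [y] by a row and a column is a single vector, to which
    Ruan's inequality for matrices of size one applies. *)
Lemma compression_le k (y : 'M[l2 R]_k) (a b : 'cV[R[i]]_k) : (X y <= 1)%E ->
  l2norm (\sum_i \sum_j (a i ord0)^*%R *: (b j ord0 *: y i j))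
    <= cvnorm a * cvnorm b.
Proof.
move=> y1; have [X0 [_ [_ [_ [XM _]]]]] := oX.
pose a' : 'rV[R[i]]_k := \row_i (a i ord0)^*%R.
rewrite -lee_fin -hX.
have -> : const_mx (\sum_i \sum_j (a i ord0)^*%R *: (b j ord0 *: y i j))
    = rmulmx (lmulmx a' y) b.
  apply/matrixP => i j; rewrite !mxE exchange_big; apply: eq_bigr => l _ /=.
  rewrite !mxE !ord1 scaler_sumr; apply: eq_bigr => m _.
  by rewrite mxE !scalerA mulrC.
have a1 : (mxopnorm a' <= (cvnorm a)%:E)%E.
  by apply: mxopnorm_row_le => i; rewrite mxE normcC.
have p0 m q (d : 'M[R[i]]_(m, q)) : (0 <= mxopnorm d)%E by rewrite mxopnormE
  lee_fin opn_ge0.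
have /andP[Xy0 _] := X0 k y.
apply: (le_trans (XM _ _ _ _ _)).
rewrite EFinM -[in leRHS](mule1 (cvnorm a)%:E).
apply: lee_pmul; [|exact: p0| |exact: mxopnorm_col_le].
  by apply: mule_ge0; [exact: p0|exact: Xy0].
by apply: lee_pmul; [exact: p0|exact: Xy0|exact: a1|exact: y1].
Qed.

Lemma entry_le n (y : 'M[l2 R]_n) i j : ((l2norm (y i j))%:E <= X y)%E.
Proof.
have [X0 [_ [_ [_ [XM _]]]]] := oX.
have d1 (p : 'I_n) : (mxopnorm (delta_mx p ord0 : 'cV[R[i]]_n) <= 1)%E.
  by have := mxopnorm_col_le (delta_mx p ord0 : 'cV[R[i]]_n);
    rewrite cvnorm_delta.
have d2 (p : 'I_n) : (mxopnorm (delta_mx ord0 p : 'rV[R[i]]_n) <= 1)%E.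
  rewrite -(cvnorm_delta R p); apply: mxopnorm_row_le => q;
    by rewrite !mxE eqxx andbT.
have p0 m q (a : 'M[R[i]]_(m, q)) : (0 <= mxopnorm a)%E by rewrite mxopnormE
  lee_fin opn_ge0.
rewrite -hX.
have -> : const_mx (y i j) =
    rmulmx (lmulmx (delta_mx ord0 i : 'rV[R[i]]_n) y) (delta_mx j ord0 :
      'cV[R[i]]_n).
  apply/matrixP => p q; rewrite !mxE (bigD1 j) //= big1 ?addr0 => [|l lj].
    rewrite !mxE !eqxx ord1 eqxx scale1r (bigD1 i) //= big1 ?addr0 => [|l li].
      by rewrite mxE !ord1 !eqxx scale1r.
    by rewrite mxE (negbTE li) andbF scale0r.
  by rewrite mxE (negbTE lj) scale0r.
have /andP[Xy0 _] := X0 n y.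
apply: (le_trans (XM _ _ _ _ _)); rewrite -[leRHS]mule1.
have h : (mxopnorm (delta_mx ord0 i : 'rV[R[i]]_n) * X y <= X y)%E.
  by rewrite -[leRHS]mul1e; apply: lee_pmul;
    [exact: p0|exact: Xy0|exact: d2|exact: lexx].
apply: lee_pmul; [|exact: p0|exact: h|exact: d1].
by apply: mule_ge0; [exact: p0|exact: Xy0].
Qed.

(** Bounded functionals are completely contractive: compress by the conjugate of
    the image [h] itself, whose inner product with [e] is [|h| ^ 2]. *)
Lemma functional_contractive k (y : 'M[l2 R]_k) (w : 'cV[R[i]]_k) e :
  (X y <= 1)%E -> l2norm e = 1 ->
  cvnorm (map_mx (fun x => l2dot x e) y *m w) <= cvnorm w.
Proof.
move=> y1 e1; set h := _ *m w.
have [->|h0] := eqVneq (cvnorm h) 0; first exact: cvnorm_ge0.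
have hp : 0 < cvnorm h by rewrite lt_neqAle eq_sym h0 cvnorm_ge0.
have := le_trans (l2dot_le _ e1) (compression_le h w y1).
have -> : l2dot (\sum_i \sum_j (h i ord0)^*%R *: (w j ord0 *: y i j)) e =
  (cvnorm h ^+ 2)%:C.
  rewrite cvnorm_sq rmorph_sum /=.
  have -> : \sum_i \sum_j (h i ord0)^*%R *: (w j ord0 *: y i j)
      = \sum_i (h i ord0)^*%R *: \sum_j w j ord0 *: y i j.
    by apply: eq_bigr => i _; rewrite scaler_sumr.
  rewrite l2dot_suml; apply: eq_bigr => i _; rewrite l2dot_suml -normc_sq
    mulrC; congr (_ * _).
  by rewrite !mxE; apply: eq_bigr => j _; rewrite mxE mulrC.
by rewrite normc_real ger0_norm ?sqr_ge0 // expr2 ler_pM2l.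
Qed.

Lemma conj_dualE n (z : 'M[l2 R]_n) :
  conj_dual X z
    = cbnorm X (@scalar_sp R n) (fun v => \matrix_(i, j) l2dot v (z i j)).
Proof.
rewrite /conj_dual /pull /conj_sp /pull /dual_sp; congr cbnorm.
by apply/funext => v; apply/matrixP => i j; rewrite !mxE.
Qed.

(** A column of [n] complete contractions has cb-norm at most [sqrt n]. *)
Lemma conj_dual_first_col_le n (e : 'I_n.+1 -> l2 R) (c : R[i]) :
  l2_orthonormal e ->
  (conj_dual X (first_col (fun i => c *: e i))
     <= (Num.sqrt n.+1%:R * normc c)%:E)%E.
Proof.
move=> oe; rewrite conj_dualE; apply: le_cbnorm => k y y1.
have K0 : 0 <= Num.sqrt n.+1%:R * normc c by rewrite mulr_ge0 ?sqrtr_ge0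
  ?normc_ge0.
apply: mxopnorm_le => // v.
apply: le_of_sq; first by rewrite mulr_ge0 ?cvnorm_ge0.
rewrite -[v in X in X <= _]submxcolK mul_mxblock_mxrow cvnorm_mxcol_sq.
pose w : 'cV[R[i]]_k := \col_j (submxcol v j) ord0 ord0.
have wv : cvnorm w ^+ 2 <= cvnorm v ^+ 2.
  have <- : \sum_j cvnorm (submxcol v j) ^+ 2 = cvnorm v ^+ 2.
    by rewrite -cvnorm_mxcol_sq submxcolK.
  rewrite cvnorm_sq; apply: ler_sum => j _.
  rewrite mxE ler_pXn2r ?nnegrE ?normc_ge0 ?cvnorm_ge0 //.
  exact: cvnorm_coord_le.
have E i l : (\sum_j map_mx (fun v => \matrix_(p, q)
       l2dot v (first_col (fun i => c *: e i) p q)) y i j *m submxcol v j) l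
         ord0
    = c^*%R * (map_mx (fun x => l2dot x (e l)) y *m w) i ord0.
  rewrite summxE mxE mulr_sumr; apply: eq_bigr => j _.
  rewrite mxE big_ord_recl big1 ?addr0 => [|p _].
    by rewrite !mxE /= [l2dot _ (c *: _)]l2dotC l2dotZ rmorphM /= -l2dotC mulrA.
  by rewrite !mxE /= l2dotC l2dot0 rmorph0 mul0r.
rewrite (eq_bigr (fun i => \sum_l normc c ^+ 2
    * normc ((map_mx (fun x => l2dot x (e l)) y *m w) i ord0) ^+ 2));
      last first.
  move=> i _; rewrite cvnorm_sq; apply: eq_bigr => l _.
  by rewrite E Normc.normcM normcC exprMn.
rewrite exchange_big /=.
apply: (@le_trans _ _ (\sum_(l < n.+1) normc c ^+ 2 * cvnorm v ^+ 2)).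
  apply: ler_sum => l _; rewrite -mulr_sumr ler_wpM2l ?sqr_ge0 // -cvnorm_sq.
  apply: le_trans wv; rewrite ler_pXn2r ?nnegrE ?cvnorm_ge0 //.
  by apply: functional_contractive => //; exact: l2_orthonormal_norm1.
rewrite sumr_const card_ord !exprMn (sqr_sqrtr (ler0n _ _)) -[leLHS]mulr_natl
  mulrA.
exact: lexx.
Qed.

(** Test the completely bounded map given by [y] on [first_col e], which lies in
    the unit ball of [X]. *)
Lemma diag_mean_le_conj_dual n (e : 'I_n.+1 -> l2 R) y : l2_orthonormal e ->
  (X (first_col e) <= 1)%E ->
  ((Num.sqrt n.+1%:R * normc (diag_mean e y))%:E <= conj_dual X y)%E.
Proof.
move=> oe Xe; rewrite conj_dualE.
set u := (X in cbnorm _ _ X).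
apply: le_trans (cbnorm_le (lexx (cbnorm X (@scalar_sp R n.+1) u)) Xe).
(* This vector selects the first column of the first block column. *)
pose v : 'cV[R[i]]_(\sum_(i < n.+1) n.+1) :=
  \mxcol_(i < n.+1) (if i == ord0 then delta_mx ord0 ord0 else 0).
have v1 : cvnorm v <= 1.
  apply: le_of_sq => //; rewrite cvnorm_mxcol_sq (bigD1 ord0) //= big1 ?addr0.
    by rewrite cvnorm_delta.
  by move=> i /negbTE i0; rewrite i0 cvnorm0 expr0n.
apply: le_trans (cvnorm_le_mxopnorm _ v1); rewrite lee_fin.
apply: (le_trans (sqrt_normc_diag_mean_le _ _)).
apply: le_of_sq; first exact: cvnorm_ge0.
rewrite sqr_sqrtr; last by apply: sumr_ge0 => i _; exact: sqr_ge0.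
rewrite mul_mxblock_mxrow cvnorm_mxcol_sq; apply: ler_sum => i _.
rewrite ler_pXn2r ?nnegrE ?normc_ge0 ?cvnorm_ge0 //.
rewrite big_ord_recl big1 ?addr0 => [|j _]; last by rewrite mulmx0.
apply: le_trans (cvnorm_coord_le _ i).
by rewrite eqxx -colE !mxE l2dotC normcC.
Qed.

End OperatorSpace.

Theorem kappa_conj_dual (X : matnorm R (l2 R)) n (theta : R) :
  operator_space X -> hilbertian X -> cbnorm (@Rsp R) X id = 1%E ->
  0 <= theta <= 1 ->
  kappa_eq (interp theta X (conj_dual X)) n.+1 (n.+1%:R `^ (theta / 2)).
Proof.
move=> oX hX cbX t01; apply: kappa_interp t01 _ => e c oe.
have X1 : (X n.+1 (first_col e) <= 1)%E.
  have cb1 : (cbnorm (@Rsp R) X id <= 1)%E by rewrite cbX.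
  by have := cbnorm_le cb1 (Rsp_first_col_le1 oe); rewrite map_mx_id.
split.
- have [_ [_ [_ [XZ _]]]] := oX.
  rewrite -map_scale_first_col XZ -[leRHS]mule1.
  by apply: lee_wpmul2l; rewrite ?lee_fin ?normc_ge0.
- exact: (conj_dual_first_col_le oX hX c oe).
- move=> y; apply: normc_diag_mean_le => i; apply: le_trans (entry_le oX hX y i
  ord0).
  by rewrite lee_fin; apply: l2dot_le; exact: l2_orthonormal_norm1.
- by move=> y; exact: (diag_mean_le_conj_dual y oe X1).
Qed.

End KappaEstimates.

(* In the second clause R + C comes first: it is R + C, and not R \cap C, that
   satisfies the hypothesis on X, and R \cap C is its conjugate dual. *)
Theorem corollary4p5 (R : realType) :
  (forall X : matnorm R (l2 R),
     operator_space X -> hilbertian X -> homogeneous X ->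
     cbnorm (@Rsp R) X id = 1%:E ->
     forall (theta : R) (n : nat), 0 <= theta <= 1 -> (0 < n)%N ->
       kappa_eq (interp theta X (conj_dual X)) n (n%:R `^ (theta / 2))) /\
  (forall (theta : R) (n : nat), 0 <= theta <= 1 -> (0 < n)%N ->
     kappa_eq (interp theta (@RplusC R) (@RcapC R)) n (n%:R `^ (theta / 2))).
Proof.
split=> [X oX hX _ cbX theta [//|n] t01 _|theta [//|n] t01 _].
  exact: kappa_conj_dual.
exact: kappa_RplusC_RcapC.
Qed.
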